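(* Let $d,n$ be positive integers and let $\mu\in{\rm Comp}_d(n)$. The linear map $\psi_\mu:E_\mu{\rm FTL}_{d,n}(q)\to{\rm Mat}_{m_\mu}({\rm TL}^\mu(q))$ is an isomorphism of $\mathbb{C}[q,q^{-1}]$-algebras with inverse map $\phi_\mu$. As a consequence, the map $$\psi_n:=\bigoplus_{\mu\in{\rm Comp}_d(n)}\psi_\mu:{\rm FTL}_{d,n}(q)\to\bigoplus_{\mu\in{\rm Comp}_d(n)}{\rm Mat}_{m_\mu}({\rm TL}^\mu(q))$$ is also an isomorphism of $\mathbb{C}[q,q^{-1}]$-algebras, with inverse map $$\phi_n:=\bigoplus_{\mu\in{\rm Comp}_d(n)}\phi_\mu:\bigoplus_{\mu\in{\rm Comp}_d(n)}{\rm Mat}_{m_\mu}({\rm TL}^\mu(q))\to{\rm FTL}_{d,n}(q).$$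
   Context: Let $q$ be an indeterminate. The Yokonuma--Hecke algebra ${\rm Y}_{d,n}(q)$ is the associative unital $\mathbb{C}[q,q^{-1}]$-algebra generated by $g_1,\dots,g_{n-1},t_1,\dots,t_n$ with relations: $g_ig_j=g_jg_i$ if $|i-j|>1$; $g_ig_{i+1}g_i=g_{i+1}g_ig_{i+1}$ for $1\le i\le n-2$; $t_it_j=t_jt_i$; $t_jg_i=g_it_{s_i(j)}$ where $s_i=(i,i+1)\in\mathfrak{S}_n$; $t_j^d=1$; and $g_i^2=q+(q-1)e_ig_i$, where $e_i=\frac1d\sum_{s=0}^{d-1}t_i^st_{i+1}^{-s}$. For $w\in\mathfrak{S}_n$ with reduced expression $s_{i_1}\cdots s_{i_r}$, $g_w:=g_{i_1}\cdots g_{i_r}$. Let $\ell$ be the length function on $\mathfrak{S}_n$. Framisation of the Temperley--Lieb algebra: ${\rm FTL}_{d,n}(q)={\rm Y}_{d,n}(q)/I_{d,n}$, where $I_{d,n}$ is the two-sided ideal generated by $e_1e_2\,g_{1,2}$ with $g_{1,2}=1+g_1+g_2+g_1g_2+g_2g_1+g_1g_2g_1$ (and $I_{d,n}=\{0\}$ if $n\le 2$). The Iwahori--Hecke algebra $\mathcal{H}_n(q)$ is the $\mathbb{C}[q,q^{-1}]$-algebra generated by $G_1,\dots,G_{n-1}$ with the braid relations $G_iG_j=G_jG_i$ ($|i-j|>1$), $G_iG_{i+1}G_i=G_{i+1}G_iG_{i+1}$, and $G_i^2=q+(q-1)G_i$; it is free with basis $G_w:=G_{i_1}\cdots G_{i_r}$,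 $w\in\mathfrak{S}_n$ ($\mathcal{H}_0(q)=\mathcal{H}_1(q)=\mathbb{C}[q,q^{-1}]$). Put $G_{i,i+1}:=1+G_i+G_{i+1}+G_iG_{i+1}+G_{i+1}G_i+G_iG_{i+1}G_i$. The Temperley--Lieb algebra is ${\rm TL}_n(q)=\mathcal{H}_n(q)/I_n$, with $I_n$ the two-sided ideal generated by $G_{1,2}$ if $n\ge3$ and $I_n=\{0\}$ if $n\le2$. ${\rm Comp}_d(n)$ is the set of $d$-tuples $\mu=(\mu_1,\dots,\mu_d)$ of non-negative integers with sum $n$. For such $\mu$, let $\mathfrak{S}_\mu=\mathfrak{S}_{\mu_1}\times\cdots\times\mathfrak{S}_{\mu_d}\subseteq\mathfrak{S}_n$ be the Young subgroup (acting on consecutive blocks), generated by the $s_j$ with $j\in J^\mu:=\{1,\dots,n-1\}\setminus\{\mu_1,\mu_1+\mu_2,\dots,\mu_1+\cdots+\mu_{d-1}\}$. $\mathcal{H}^\mu(q)\cong\mathcal{H}_{\mu_1}(q)\otimes\cdots\otimes\mathcal{H}_{\mu_d}(q)$ is the subalgebra of $\mathcal{H}_n(q)$ generated by $\{G_j\mid j\in J^\mu\}$, with basis $\{G_w\mid w\in\mathfrak{S}_\mu\}$. ${\rm TL}^\mu(q):={\rm TL}_{\mu_1}(q)\otimes\cdots\otimes{\rm TL}_{\mu_d}(q)$ (over $\mathbb{C}[q,q^{-1}]$), and $\rho^\mu:\mathcal{H}^\mu(q)\twoheadrightarrow{\rm TL}^\mu(q)$ is the tensor product of the natural surjections $\mathcal{H}_{\mu_i}(q)\twoheadrightarrow{\rm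 TL}_{\mu_i}(q)$; the induced (entrywise) surjection ${\rm Mat}_{m_\mu}(\mathcal{H}^\mu(q))\twoheadrightarrow{\rm Mat}_{m_\mu}({\rm TL}^\mu(q))$ is also denoted $\rho^\mu$. Let $\{\xi_1,\dots,\xi_d\}$ be the $d$-th roots of unity in $\mathbb{C}$ (ordered arbitrarily), and $\mathcal{A}_{d,n}\cong(\mathbb{Z}/d\mathbb{Z})^n$ the group generated by $t_1,\dots,t_n$. For an irreducible character $\chi$ of $\mathcal{A}_{d,n}$ let $E_\chi:=\prod_{j=1}^n\bigl(\frac1d\sum_{s=0}^{d-1}\chi(t_j)^st_j^{-s}\bigr)$. $\mathfrak{S}_n$ acts on characters by $w(\chi)(t_j)=\chi(t_{w^{-1}(j)})$. Let $\chi_1^\mu$ be the character with $\chi_1^\mu(t_j)=\xi_i$ for $\mu_1+\cdots+\mu_{i-1}<j\le\mu_1+\cdots+\mu_i$. Let $\pi_{\mu,1}=1,\dots,\pi_{\mu,m_\mu}$, $m_\mu=\frac{n!}{\mu_1!\cdots\mu_d!}$, be the minimal length representatives of the left cosets $\mathfrak{S}_n/\mathfrak{S}_\mu$, and $\chi_k^\mu:=\pi_{\mu,k}(\chi_1^\mu)$. Put $E_\mu:=\sum_{k=1}^{m_\mu}E_{\chi_k^\mu}$. The $E_\mu$ form a complete set of central orthogonal idempotents of ${\rm Y}_{d,n}(q)$; the image of $E_\mu$ in ${\rm FTL}_{d,n}(q)$ is also written $E_\mu$, so ${\rm FTL}_{d,n}(q)=\bigoplus_\mu E_\mu{\rm FTL}_{d,n}(q)$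 and $E_\mu{\rm FTL}_{d,n}(q)\cong E_\mu{\rm Y}_{d,n}(q)/E_\mu I_{d,n}$. Let $\theta^\mu:E_\mu{\rm Y}_{d,n}(q)\twoheadrightarrow E_\mu{\rm FTL}_{d,n}(q)$ be the natural surjection. Let $M_{k,l}$ be the elementary $m_\mu\times m_\mu$ matrices and $U_\mu:=\sum_kq^{\ell(\pi_{\mu,k})/2}M_{k,k}$. Over $\mathbb{C}[q^{1/2},q^{-1/2}]$ define the linear map $\widetilde{\Psi}_\mu(E_{\chi_k^\mu}g_w):=q^{\frac12(\ell(w)-\ell(\pi_{\mu,k}^{-1}w\pi_{\mu,l}))}G_{\pi_{\mu,k}^{-1}w\pi_{\mu,l}}M_{k,l}$, where $l$ is determined by $w(\chi_l^\mu)=\chi_k^\mu$. The map $\Psi_\mu:E_\mu{\rm Y}_{d,n}(q)\to{\rm Mat}_{m_\mu}(\mathcal{H}^\mu(q))$, $\Psi_\mu(E_\mu a)=U_\mu\widetilde{\Psi}_\mu(E_\mu a)U_\mu^{-1}$, is an isomorphism of $\mathbb{C}[q,q^{-1}]$-algebras; let $\Phi_\mu$ be its inverse. $\psi_\mu:E_\mu{\rm FTL}_{d,n}(q)\to{\rm Mat}_{m_\mu}({\rm TL}^\mu(q))$ is the unique $\mathbb{C}[q,q^{-1}]$-algebra homomorphism with $\psi_\mu\circ\theta^\mu=\rho^\mu\circ\Psi_\mu$, and $\phi_\mu:{\rm Mat}_{m_\mu}({\rm TL}^\mu(q))\to E_\mu{\rm FTL}_{d,n}(q)$ is the unique $\mathbb{C}[q,q^{-1}]$-algebra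 homomorphism with $\phi_\mu\circ\rho^\mu=\theta^\mu\circ\Phi_\mu$ (both exist). *)

(* Defs.v *)
From HB Require Import structures.
From mathcomp Require Import all_boot all_order all_algebra all_fingroup.
From mathcomp Require Import fraction generic_quotient ring_quotient.
From mathcomp Require Import zify finmap boolp classical_sets monalg.

Set Implicit Arguments.
Unset Strict Implicit.
Unset Printing Implicit Defensive.

Import GRing.Theory.
Local Open Scope ring_scope.
Local Open Scope quotient_scope.
Local Open Scope classical_set_scope.

(* ---------------------------------------------------------------------- *)
(* Associative unital algebras over a commutative ring.                   *)

(* Not MathComp's [algType], which requires [1 != 0]: the quotient by an
   arbitrary two-sided ideal has to be allowed. *)
HB.mixin Record isAssocAlgebra (K : comNzRingType) A of GRing.PzRing A := {
  scal : K -> A;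
  scal_is_zmod_morphism : zmod_morphism scal;
  scal_is_monoid_morphism : monoid_morphism scal;
  scal_central : forall k x, scal k * x = x * scal k
}.

#[short(type="assocAlgType")]
HB.structure Definition AssocAlgebra (K : comNzRingType) :=
  { A of GRing.PzRing A & isAssocAlgebra K A }.

Section Scaling.
Variables (K : comNzRingType) (A : assocAlgType K).

HB.instance Definition _ := GRing.isZmodMorphism.Build K A scal
  scal_is_zmod_morphism.
HB.instance Definition _ := GRing.isMonoidMorphism.Build K A scal
  scal_is_monoid_morphism.

Definition kscale (k : K) (x : A) : A := scal k * x.

Lemma kscaleA a b x : kscale a (kscale b x) = kscale (a * b) x.
Proof. by rewrite /kscale rmorphM mulrA. Qed.
Lemma kscale1 : left_id 1 kscale.
Proof. by move=> x; rewrite /kscale rmorph1 mul1r. Qed.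
Lemma kscaleDr : right_distributive kscale +%R.
Proof. by move=> a x y; rewrite /kscale mulrDr. Qed.
Lemma kscaleDl x : {morph kscale^~ x : a b / a + b}.
Proof. by move=> a b; rewrite /kscale rmorphD mulrDl. Qed.

End Scaling.

(* The multiplications and the units are explicit, because the algebra [E A]
   below is introduced for every [E] and satisfies the unit laws only when [E]
   is a central idempotent. *)
Definition alg_hom_for (K : comNzRingType) (V W : lmodType K)
    (f : V -> W) (mulV : V -> V -> V) (oneV : V)
    (mulW : W -> W -> W) (oneW : W) : Prop :=
  [/\ linear f, {morph f : x y / mulV x y >-> mulW x y} & f oneV = oneW].

Definition alg_iso_for (K : comNzRingType) (V W : lmodType K)
    (f : V -> W) (g : W -> V) (mulV : V -> V -> V) (oneV : V)
    (mulW : W -> W -> W) (oneW : W) : Prop :=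
  [/\ alg_hom_for f mulV oneV mulW oneW, cancel f g & cancel g f].

(* ---------------------------------------------------------------------- *)
(* The free algebra on X, i.e. the monoid algebra of the free monoid.     *)

Definition free_alg (K : comNzRingType) (X : choiceType) :=
  {malg K[{fmonom X}]}.
HB.instance Definition _ K X := Choice.on (free_alg K X).

(* The operations of [malg], locked to keep conversion from unfolding them. *)
HB.lock Definition free_add (K : comNzRingType) (X : choiceType)
  (x y : free_alg K X) : free_alg K X := (x : {malg K[{fmonom X}]}) + (y : {malg K[{fmonom X}]}).
HB.lock Definition free_opp (K : comNzRingType) (X : choiceType)
  (x : free_alg K X) : free_alg K X := - (x : {malg K[{fmonom X}]}).
HB.lock Definition free_mul (K : comNzRingType) (X : choiceType)
  (x y : free_alg K X) : free_alg K X := (x : {malg K[{fmonom X}]}) * (y : {malg K[{fmonom X}]}).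
HB.lock Definition free_scal (K : comNzRingType) (X : choiceType) (k : K) :
  free_alg K X := malgC k.
HB.lock Definition free_var (K : comNzRingType) (X : choiceType) (x : X) :
  free_alg K X := mkmalgU (fmu x) 1.

Section FreeAlgebra.
Variables (K : comNzRingType) (X : choiceType).
Local Notation malg := {malg K[{fmonom X}]}.
Local Notation free_alg := (free_alg K X).
Local Notation free_add := (@free_add K X).
Local Notation free_opp := (@free_opp K X).
Local Notation free_mul := (@free_mul K X).
Local Notation free_scal := (@free_scal K X).

Fact free_addA : associative free_add.
Proof. by rewrite free_add.unlock; exact: (@addrA malg). Qed.
Fact free_addC : commutative free_add.
Proof. by rewrite free_add.unlock; exact: (@addrC malg). Qed.
Fact free_add0 : left_id (free_scal 0) free_add.
Proof.
by rewrite free_add.unlock free_scal.unlock malgC0E; exact: (@add0r malg).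
Qed.
Fact free_addN : left_inverse (free_scal 0) free_opp free_add.
Proof.
rewrite free_add.unlock free_opp.unlock free_scal.unlock malgC0E.
exact: (@addNr malg).
Qed.
HB.instance Definition _ := GRing.isZmodule.Build free_alg
  free_addA free_addC free_add0 free_addN.

Fact free_mulA : associative free_mul.
Proof. by rewrite free_mul.unlock; exact: (@mulrA malg). Qed.
Fact free_mul1 : left_id (free_scal 1) free_mul.
Proof.
by rewrite free_mul.unlock free_scal.unlock (rmorph1 malgC); exact: (@mul1r malg).
Qed.
Fact free_mulr1 : right_id (free_scal 1) free_mul.
Proof.
by rewrite free_mul.unlock free_scal.unlock (rmorph1 malgC); exact: (@mulr1 malg).
Qed.
Fact free_mulDl : left_distributive free_mul free_add.
Proof.
by rewrite free_mul.unlock free_add.unlock; exact: (@mulrDl malg).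
Qed.
Fact free_mulDr : right_distributive free_mul free_add.
Proof.
by rewrite free_mul.unlock free_add.unlock; exact: (@mulrDr malg).
Qed.
HB.instance Definition _ := GRing.Zmodule_isPzRing.Build free_alg
  free_mulA free_mul1 free_mulr1 free_mulDl free_mulDr.

Lemma free_subE (x y : free_alg) : x - y = (x : malg) - (y : malg).
Proof.
transitivity (free_add x (free_opp y)); first by [].
by rewrite free_add.unlock free_opp.unlock.
Qed.
Lemma free_mulE (x y : free_alg) : x * y = (x : malg) * (y : malg).
Proof.
transitivity (free_mul x y); first by [].
by rewrite free_mul.unlock.
Qed.

Fact free_scal_zmod : zmod_morphism free_scal.
Proof. by move=> a b; rewrite free_subE free_scal.unlock; exact: (raddfB malgC). Qed.
Fact free_scal_monoid : monoid_morphism free_scal.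
Proof.
by split=> // a b; rewrite free_mulE free_scal.unlock; exact: (rmorphM malgC).
Qed.
Fact free_scal_central k (x : free_alg) : free_scal k * x = x * free_scal k.
Proof.
rewrite !free_mulE free_scal.unlock !malgM_def fgmulUg fgmulgU.
by apply: eq_bigr => m _; rewrite mul1m mulm1 mulrC.
Qed.
HB.instance Definition _ := isAssocAlgebra.Build K free_alg
  free_scal_zmod free_scal_monoid free_scal_central.

(* The map extending [s] on scalars and [h] on variables; a ring homomorphism
   when [s] is one whose image commutes with that of [h]. *)
Definition free_eval (B : pzRingType) (s : K -> B) (h : X -> B)
    (p : free_alg) : B :=
  \sum_(m <- msupp p) s (mcoeff m p) * \prod_(x <- (m : seq X)) h x.

Section Eval.
Variables (B : pzRingType) (s : {rmorphism K -> B}) (h : X -> B).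

Let hm (m : {fmonom X}) : B := \prod_(x <- (m : seq X)) h x.

Lemma free_evalEw (D : {fset {fmonom X}}) (p : malg) :
  (msupp p `<=` D)%fset -> free_eval s h p = \sum_(m <- D) s (mcoeff m p) * hm m.
Proof.
move=> le; rewrite [LHS](big_fset_incl _ le) //= => m _ /mcoeff_outdom ->.
by rewrite rmorph0 mul0r.
Qed.

Fact free_eval_malgB (p r : malg) :
  free_eval s h (p - r) = free_eval s h p - free_eval s h r.
Proof.
rewrite (free_evalEw (fsubsetUl (msupp p) (msupp r))).
rewrite (free_evalEw (fsubsetUr (msupp p) (msupp r))).
rewrite (free_evalEw (msuppB_le p r)) -sumrB; apply: eq_bigr => m _.
by rewrite -mulrBl -rmorphB mcoeffB.
Qed.

Fact free_eval_is_zmod_morphism : zmod_morphism (free_eval s h).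
Proof. by move=> p r; rewrite free_subE free_eval_malgB. Qed.
HB.instance Definition _ := GRing.isZmodMorphism.Build free_alg B
  (free_eval s h) free_eval_is_zmod_morphism.

Lemma free_evalU c m : free_eval s h (mkmalgU m c) = s c * hm m.
Proof. by rewrite (free_evalEw msuppU_le) big_seq_fset1 mcoeffUU. Qed.

Lemma free_eval_scal k : free_eval s h (scal k) = s k.
Proof.
rewrite -[scal k]/(free_scal k) free_scal.unlock.
by rewrite free_evalU /hm fm1 big_nil mulr1.
Qed.

Lemma free_eval_var x : free_eval s h (free_var K x) = h x.
Proof. by rewrite free_var.unlock free_evalU rmorph1 mul1r /hm fmU big_seq1. Qed.

Hypothesis sh : forall k x, s k * h x = h x * s k.

Lemma free_eval_is_monoid_morphism : monoid_morphism (free_eval s h).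
Proof.
split=> [|p r]; first by rewrite -(rmorph1 (@scal K free_alg)) free_eval_scal rmorph1.
have shm k (m : seq X) : s k * \prod_(x <- m) h x = \prod_(x <- m) h x * s k.
  elim: m => [|x m IHm]; first by rewrite big_nil mulr1 mul1r.
  by rewrite big_cons mulrA sh -!mulrA IHm.
have sumE (I : Type) (t : seq I) (G : I -> malg) :
    free_eval s h (\sum_(i <- t) G i) = \sum_(i <- t) free_eval s h (G i).
  have e0 : free_eval s h (0 : malg) = 0.
    by have := free_eval_malgB 0 0; rewrite !subrr.
  have eD (x y : malg) : free_eval s h (x + y) = free_eval s h x + free_eval s h y.
    have -> : x + y = x - (0 - y) by rewrite sub0r opprK.
    by rewrite !free_eval_malgB e0 sub0r opprK.
  elim: t => [|i t IHt]; first by rewrite !big_nil.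
  by rewrite !big_cons -IHt eD.
rewrite free_mulE malgME sumE mulr_suml /=; apply: eq_bigr => m _.
rewrite sumE mulr_sumr /=; apply: eq_bigr => l _.
rewrite free_evalU rmorphM /hm fmM big_cat /= -!mulrA; congr (_ * _).
by rewrite !mulrA shm.
Qed.

End Eval.

End FreeAlgebra.

(* ---------------------------------------------------------------------- *)
(* The quotient of B by the two-sided ideal generated by S.               *)

Definition two_sided_ideal (B : pzRingType) (I : set B) : Prop :=
  [/\ I 0, (forall x y, I x -> I y -> I (x - y)),
      (forall a x, I x -> I (a * x)) & (forall a x, I x -> I (x * a))].

Definition gen_ideal (B : pzRingType) (S : set B) : {pred B} :=
  fun x => `[< forall I : set B, two_sided_ideal I -> S `<=` I -> I x >].

Section Ideal.
Variables (B : pzRingType) (S : set B).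
Local Notation gen_ideal := (gen_ideal S).

Lemma gen_idealP x :
  reflect (forall I : set B, two_sided_ideal I -> S `<=` I -> I x)
          (x \in gen_ideal).
Proof. exact: asboolP. Qed.

Fact gen_ideal_zmod_closed : zmod_closed gen_ideal.
Proof.
split=> [|x y /gen_idealP xI /gen_idealP yI]; apply/gen_idealP => I Iid SI.
  by case: Iid.
by case: (Iid) => _ IB _ _; apply: IB; [apply: xI|apply: yI].
Qed.
HB.instance Definition _ :=
  GRing.isZmodClosed.Build B gen_ideal gen_ideal_zmod_closed.

Lemma gen_ideal_mulr a x : x \in gen_ideal -> x * a \in gen_ideal.
Proof.
move/gen_idealP => xI; apply/gen_idealP => I Iid SI.
by case: (Iid) => _ _ _ IM; apply: IM; apply: xI.
Qed.
Lemma gen_ideal_mull a x : x \in gen_ideal -> a * x \in gen_ideal.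
Proof.
move/gen_idealP => xI; apply/gen_idealP => I Iid SI.
by case: (Iid) => _ _ IM _; apply: IM; apply: xI.
Qed.

End Ideal.

Definition quot_alg (B : pzRingType) (S : set B) := Quotient.quot (gen_ideal S).
HB.instance Definition _ B S := GRing.Zmodule.on (@quot_alg B S).
HB.instance Definition _ B S := EqQuotient.on (@quot_alg B S).

HB.lock Definition cls (B : pzRingType) (S : set B) (x : B) : quot_alg S :=
  \pi_(quot_alg S) x.
HB.lock Definition quot_mul (B : pzRingType) (S : set B) (u v : quot_alg S) :
  quot_alg S := cls S (repr u * repr v).
HB.lock Definition quot_scal (K : comNzRingType) (B : assocAlgType K)
  (S : set B) (k : K) : quot_alg S := cls S (scal k).

(* The map induced on the quotient by an additive [f] that vanishes on the
   ideal. *)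
Definition quot_lift (B : pzRingType) (S : set B) (T : Type) (f : B -> T)
    (u : quot_alg S) : T :=
  f (repr u).

Arguments cls {B S} x.

Section QuotientRing.
Variables (B : pzRingType) (S : set B).
Local Notation gen_ideal := (gen_ideal S).
Local Notation quot_alg := (quot_alg S).
Local Notation cls := (@cls B S).
Local Notation quot_mul := (@quot_mul B S).

Lemma cls_eq x y : (cls x == cls y) = (x - y \in gen_ideal).
Proof. by rewrite cls.unlock Quotient.idealrBE. Qed.

Lemma cls_surj (u : quot_alg) : exists x, u = cls x.
Proof. by exists (repr u); rewrite cls.unlock reprK. Qed.

Fact cls_is_zmod_morphism : zmod_morphism cls.
Proof. by rewrite cls.unlock; exact: raddfB. Qed.
HB.instance Definition _ :=
  GRing.isZmodMorphism.Build B quot_alg cls cls_is_zmod_morphism.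

Definition quot_one : quot_alg := cls 1.

Lemma quot_mulE x y : quot_mul (cls x) (cls y) = cls (x * y).
Proof.
apply/eqP; rewrite quot_mul.unlock cls_eq.
have r z : repr (cls z) - z \in gen_ideal by rewrite -cls_eq cls.unlock reprK.
rewrite -(subrKA (x * repr (cls y))) -mulrBl -mulrBr.
by apply: rpredD; [exact/gen_ideal_mulr/r|exact/gen_ideal_mull/r].
Qed.

Fact quot_mulA : associative quot_mul.
Proof.
move=> u v w; have [x ->] := cls_surj u; have [y ->] := cls_surj v.
by have [z ->] := cls_surj w; rewrite !quot_mulE mulrA.
Qed.
Fact quot_mul1 : left_id quot_one quot_mul.
Proof. by move=> u; have [x ->] := cls_surj u; rewrite quot_mulE mul1r. Qed.
Fact quot_mulr1 : right_id quot_one quot_mul.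
Proof. by move=> u; have [x ->] := cls_surj u; rewrite quot_mulE mulr1. Qed.
Fact quot_mulDl : left_distributive quot_mul +%R.
Proof.
move=> u v w; have [x ->] := cls_surj u; have [y ->] := cls_surj v.
by have [z ->] := cls_surj w; rewrite -raddfD !quot_mulE mulrDl raddfD.
Qed.
Fact quot_mulDr : right_distributive quot_mul +%R.
Proof.
move=> u v w; have [x ->] := cls_surj u; have [y ->] := cls_surj v.
by have [z ->] := cls_surj w; rewrite -raddfD !quot_mulE mulrDr raddfD.
Qed.
HB.instance Definition _ := GRing.Zmodule_isPzRing.Build quot_alg
  quot_mulA quot_mul1 quot_mulr1 quot_mulDl quot_mulDr.

Fact cls_is_monoid_morphism : monoid_morphism cls.
Proof. by split=> // x y; rewrite -quot_mulE. Qed.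
HB.instance Definition _ :=
  GRing.isMonoidMorphism.Build B quot_alg cls cls_is_monoid_morphism.

Lemma cls_rel x : S x -> cls x = 0.
Proof.
move=> Sx; rewrite -(rmorph0 cls); apply/eqP; rewrite cls_eq subr0.
by apply/gen_idealP => I _; apply.
Qed.

Lemma quot_liftE (T : pzRingType) (f : B -> T) :
  zmod_morphism f -> monoid_morphism f -> (forall x, S x -> f x = 0) ->
  forall x, quot_lift f (cls x) = f x.
Proof.
move=> fB [_ fM] fS x; rewrite /quot_lift.
have f0 : f 0 = 0 by have := fB 0 0; rewrite !subrr.
apply/eqP; rewrite -subr_eq0 -fB; apply/eqP.
have /gen_idealP : repr (cls x) - x \in gen_ideal by rewrite -cls_eq cls.unlock reprK.
move/(_ (fun y => f y = 0)); apply=> //; split=> // [y z fy fz|a y fy|a y fy].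
- by rewrite fB fy fz subr0.
- by rewrite fM fy mulr0.
- by rewrite fM fy mul0r.
Qed.

End QuotientRing.

Section QuotientAlgebra.
Variables (K : comNzRingType) (B : assocAlgType K) (S : set B).
Local Notation quot_alg := (quot_alg S).
Local Notation quot_scal := (@quot_scal K B S).

Fact quot_scal_zmod : zmod_morphism quot_scal.
Proof. by move=> a b; rewrite quot_scal.unlock !raddfB. Qed.
Fact quot_scal_monoid : monoid_morphism quot_scal.
Proof. by split=> [|a b]; rewrite quot_scal.unlock ?rmorph1 ?rmorphM. Qed.
Fact quot_scal_central k u : quot_scal k * u = u * quot_scal k.
Proof.
by rewrite quot_scal.unlock; have [x ->] := cls_surj u; rewrite -!rmorphM scal_central.
Qed.
HB.instance Definition _ := isAssocAlgebra.Build K quot_alg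
  quot_scal_zmod quot_scal_monoid quot_scal_central.
HB.instance Definition _ := GRing.Zmodule_isLmodule.Build K quot_alg
  (@kscaleA K quot_alg) (@kscale1 K quot_alg)
  (@kscaleDr K quot_alg) (@kscaleDl K quot_alg).

Lemma cls_scal k : cls (scal k) = scal k :> quot_alg.
Proof. by rewrite -[RHS]/(quot_scal k) quot_scal.unlock. Qed.

End QuotientAlgebra.

(* ---------------------------------------------------------------------- *)
(* The tensor product over K of a finite family of algebras, presented as the
   algebra generated by pairwise commuting copies of the A_i.  The symbol
   [tens_in i a] stands for 1 ⊗ ... ⊗ a ⊗ ... ⊗ 1, with [a] at position [i]. *)

Section TensorProduct.
Variables (K : comNzRingType) (m : nat) (A : 'I_m -> assocAlgType K).

Definition tens_var (i : 'I_m) (a : A i) : free_alg K {i : 'I_m & A i} :=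
  free_var K (Tagged (fun i => A i) a).

Inductive tens_rel : set (free_alg K {i : 'I_m & A i}) :=
| tens_rel_add i (a b : A i) :
    tens_rel (tens_var (a + b) - (tens_var a + tens_var b))
| tens_rel_mul i (a b : A i) :
    tens_rel (tens_var (a * b) - tens_var a * tens_var b)
| tens_rel_scal i (k : K) :
    tens_rel (tens_var (scal k : A i) - scal k)
| tens_rel_comm i j (a : A i) (b : A j) : i != j ->
    tens_rel (tens_var a * tens_var b - tens_var b * tens_var a).

Definition tens_alg := quot_alg tens_rel.
HB.instance Definition _ := AssocAlgebra.on tens_alg.
HB.instance Definition _ := GRing.Lmodule.on tens_alg.

Definition tens_in (i : 'I_m) (a : A i) : tens_alg := cls (tens_var a).

Definition pure_tensor (a : forall i, A i) : tens_alg :=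
  \prod_(i < m) tens_in (a i).

End TensorProduct.

(* ---------------------------------------------------------------------- *)
(* The subalgebra generated by S.                                         *)

Section Subalgebra.
Variables (K : comNzRingType) (B : assocAlgType K) (S : set B).

Definition subalgebra (P : set B) : Prop :=
  [/\ (forall k, P (scal k)), (forall x y, P x -> P y -> P (x - y))
    & (forall x y, P x -> P y -> P (x * y))].

Definition gen_subalg : {pred B} :=
  fun x => `[< forall P : set B, subalgebra P -> S `<=` P -> P x >].

Record sub_alg := SubAlg { sub_val : B; sub_valP : sub_val \in gen_subalg }.
HB.instance Definition _ := [isSub for sub_val].
HB.instance Definition _ := [Choice of sub_alg by <:].

Lemma gen_subalg_scal k : scal k \in gen_subalg.
Proof. by apply/asboolP => P [Ps _ _] _; exact: Ps. Qed.

Fact gen_subalg_subring_closed : subring_closed gen_subalg.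
Proof.
split=> [|x y /asboolP xP /asboolP yP|x y /asboolP xP /asboolP yP].
- by rewrite -(rmorph1 (@scal K B)); exact: gen_subalg_scal.
- apply/asboolP => P Pa SP; case: (Pa) => _ PB _.
  by apply: PB; [exact: xP|exact: yP].
- apply/asboolP => P Pa SP; case: (Pa) => _ _ PM.
  by apply: PM; [exact: xP|exact: yP].
Qed.
HB.instance Definition _ := GRing.SubChoice_isSubPzRing.Build B gen_subalg
  sub_alg gen_subalg_subring_closed.

Definition sub_scal (k : K) : sub_alg := SubAlg (gen_subalg_scal k).
Fact sub_scal_zmod : zmod_morphism sub_scal.
Proof. by move=> a b; apply: val_inj; rewrite raddfB /= raddfB. Qed.
Fact sub_scal_monoid : monoid_morphism sub_scal.
Proof.
by split=> [|a b]; apply: val_inj; rewrite ?rmorph1 ?rmorphM /= ?rmorph1 ?rmorphM.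
Qed.
Fact sub_scal_central k x : sub_scal k * x = x * sub_scal k.
Proof. by apply: val_inj; rewrite !rmorphM /= scal_central. Qed.
HB.instance Definition _ := isAssocAlgebra.Build K sub_alg
  sub_scal_zmod sub_scal_monoid sub_scal_central.
HB.instance Definition _ := GRing.Zmodule_isLmodule.Build K sub_alg
  (@kscaleA K sub_alg) (@kscale1 K sub_alg)
  (@kscaleDr K sub_alg) (@kscaleDl K sub_alg).

End Subalgebra.

(* ---------------------------------------------------------------------- *)
(* Mat_m(B) as a K-algebra ('M[B]_m carries the B-module structure).      *)

Section MatrixAlgebra.
Variables (K : comNzRingType) (B : assocAlgType K) (m : nat).

Definition mat_alg := 'M[B]_m.
HB.instance Definition _ := GRing.PzRing.on mat_alg.

Definition mat_scal (k : K) : mat_alg := (scal k : B)%:M.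
Fact mat_scal_zmod : zmod_morphism mat_scal.
Proof. by move=> a b; rewrite /mat_scal !raddfB. Qed.
Fact mat_scal_monoid : monoid_morphism mat_scal.
Proof. by split=> [|a b]; rewrite /mat_scal ?rmorph1 ?rmorphM. Qed.
Fact mat_scal_central k x : mat_scal k * x = x * mat_scal k.
Proof.
have -> : mat_scal k * x = mat_scal k *m x by [].
have -> : x * mat_scal k = x *m mat_scal k by [].
apply/matrixP => i j; rewrite mul_scalar_mx !mxE (bigD1 j) //= !mxE eqxx.
rewrite big1 ?addr0 ?mulr1n ?scal_central // => l lj.
by rewrite !mxE (negPf lj) mulr0.
Qed.
HB.instance Definition _ := isAssocAlgebra.Build K mat_alg
  mat_scal_zmod mat_scal_monoid mat_scal_central.
HB.instance Definition _ := GRing.Zmodule_isLmodule.Build K mat_alg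
  (@kscaleA K mat_alg) (@kscale1 K mat_alg)
  (@kscaleDr K mat_alg) (@kscaleDl K mat_alg).

End MatrixAlgebra.

(* ---------------------------------------------------------------------- *)
(* The direct sum (= product) of a finite family of algebras.             *)

Section DirectSum.
Variables (K : comNzRingType) (I : finType) (A : I -> assocAlgType K).

Definition dsum_alg := forall i, A i.
HB.instance Definition _ := Choice.on dsum_alg.

Let zero : dsum_alg := fun=> 0.
Let opp (x : dsum_alg) : dsum_alg := fun i => - x i.
Let add (x y : dsum_alg) : dsum_alg := fun i => x i + y i.
Let one : dsum_alg := fun=> 1.
Let mul (x y : dsum_alg) : dsum_alg := fun i => x i * y i.

Fact dsum_addA : associative add.
Proof. by move=> x y z; apply: functional_extensionality_dep => i; exact: addrA. Qed.
Fact dsum_addC : commutative add.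
Proof. by move=> x y; apply: functional_extensionality_dep => i; exact: addrC. Qed.
Fact dsum_add0 : left_id zero add.
Proof. by move=> x; apply: functional_extensionality_dep => i; exact: add0r. Qed.
Fact dsum_addN : left_inverse zero opp add.
Proof. by move=> x; apply: functional_extensionality_dep => i; exact: addNr. Qed.
HB.instance Definition _ := GRing.isZmodule.Build dsum_alg
  dsum_addA dsum_addC dsum_add0 dsum_addN.

Fact dsum_mulA : associative mul.
Proof. by move=> x y z; apply: functional_extensionality_dep => i; exact: mulrA. Qed.
Fact dsum_mul1 : left_id one mul.
Proof. by move=> x; apply: functional_extensionality_dep => i; exact: mul1r. Qed.
Fact dsum_mulr1 : right_id one mul.
Proof. by move=> x; apply: functional_extensionality_dep => i; exact: mulr1. Qed.
Fact dsum_mulDl : left_distributive mul +%R.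
Proof. by move=> x y z; apply: functional_extensionality_dep => i; exact: mulrDl. Qed.
Fact dsum_mulDr : right_distributive mul +%R.
Proof. by move=> x y z; apply: functional_extensionality_dep => i; exact: mulrDr. Qed.
HB.instance Definition _ := GRing.Zmodule_isPzRing.Build dsum_alg
  dsum_mulA dsum_mul1 dsum_mulr1 dsum_mulDl dsum_mulDr.

Definition dsum_scal (k : K) : dsum_alg := fun=> scal k.
Fact dsum_scal_zmod : zmod_morphism dsum_scal.
Proof.
by move=> a b; apply: functional_extensionality_dep => i; exact: raddfB.
Qed.
Fact dsum_scal_monoid : monoid_morphism dsum_scal.
Proof.
split=> [|a b]; apply: functional_extensionality_dep => i;
  [exact: rmorph1|exact: rmorphM].
Qed.
Fact dsum_scal_central k x : dsum_scal k * x = x * dsum_scal k.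
Proof. by apply: functional_extensionality_dep => i; exact: scal_central. Qed.
HB.instance Definition _ := isAssocAlgebra.Build K dsum_alg
  dsum_scal_zmod dsum_scal_monoid dsum_scal_central.
HB.instance Definition _ := GRing.Zmodule_isLmodule.Build K dsum_alg
  (@kscaleA K dsum_alg) (@kscale1 K dsum_alg)
  (@kscaleDr K dsum_alg) (@kscaleDl K dsum_alg).

End DirectSum.

(* ---------------------------------------------------------------------- *)
(* E B = { E b | b in B }; for a central idempotent E it is an algebra with
   unit E.                                                                *)

Section Corner.
Variables (K : comNzRingType) (B : assocAlgType K) (E : B).

Definition corner_pred : {pred B} := fun x => `[< exists b, x = E * b >].

Record corner := Corner { corner_val : B; _ : corner_val \in corner_pred }.
HB.instance Definition _ := [isSub for corner_val].
HB.instance Definition _ := [Choice of corner by <:].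

Fact corner_zmod_closed : zmod_closed corner_pred.
Proof.
split=> [|x y /asboolP[a ->] /asboolP[b ->]]; apply/asboolP.
  by exists 0; rewrite mulr0.
by exists (a - b); rewrite mulrBr.
Qed.
HB.instance Definition _ := GRing.isZmodClosed.Build B corner_pred
  corner_zmod_closed.
HB.instance Definition _ := [SubChoice_isSubZmodule of corner by <:].

Fact corner_projP (b : B) : E * b \in corner_pred.
Proof. by apply/asboolP; exists b. Qed.
(* the element E b of E B *)
Definition corner_proj (b : B) : corner := Corner (corner_projP b).

Fact corner_mulP (x : corner) (b : B) : val x * b \in corner_pred.
Proof.
have /asboolP[a ->] := valP x.
by apply/asboolP; exists (a * b); rewrite mulrA.
Qed.
Definition corner_mul (x y : corner) : corner := Corner (corner_mulP x (val y)).
Definition corner_one : corner := corner_proj 1.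
Definition corner_scale (k : K) (x : corner) : corner :=
  Corner (corner_mulP x (scal k)).

Fact corner_scaleA a b x :
  corner_scale a (corner_scale b x) = corner_scale (a * b) x.
Proof. by apply: val_inj; rewrite /= -mulrA -rmorphM mulrC. Qed.
Fact corner_scale1 : left_id 1 corner_scale.
Proof. by move=> x; apply: val_inj; rewrite /= rmorph1 mulr1. Qed.
Fact corner_scaleDr : right_distributive corner_scale +%R.
Proof. by move=> a x y; apply: val_inj; rewrite /= mulrDl. Qed.
Fact corner_scaleDl x : {morph corner_scale^~ x : a b / a + b}.
Proof. by move=> a b; apply: val_inj; rewrite /= rmorphD mulrDr. Qed.
HB.instance Definition _ := GRing.Zmodule_isLmodule.Build K corner
  corner_scaleA corner_scale1 corner_scaleDr corner_scaleDl.

End Corner.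

Section CornerMap.
Variables (K : comNzRingType) (B B' : assocAlgType K).
Variables (f : {rmorphism B -> B'}) (E : B).

Fact corner_mapP (x : corner E) : f (val x) \in corner_pred (f E).
Proof.
have /asboolP[b ->] := valP x.
by apply/asboolP; exists (f b); rewrite rmorphM.
Qed.
(* the restriction of f to E B -> f(E) B' *)
Definition corner_map (x : corner E) : corner (f E) := Corner (corner_mapP x).

End CornerMap.

Arguments corner_map {K B B'} f {E} x.

(* ---------------------------------------------------------------------- *)
(* The ring F[q, q^-1], as the subring of F(q) of all p / q^k.            *)

Section Laurent.
Variable F : fieldType.
Local Notation tofrac := (@FracField.tofrac {poly F}).

Definition laurent_frac (p : {poly F}) (k : nat) : {fraction {poly F}} :=
  tofrac p / tofrac 'X^k.

Definition laurent_pred : {pred {fraction {poly F}}} :=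
  fun x => `[< exists p k, x = laurent_frac p k >].

Record laurent :=
  Laurent { laurent_val : {fraction {poly F}}; _ : laurent_val \in laurent_pred }.
HB.instance Definition _ := [isSub for laurent_val].
HB.instance Definition _ := [Choice of laurent by <:].

Fact laurent_fracP p k : laurent_frac p k \in laurent_pred.
Proof. by apply/asboolP; exists p, k. Qed.

Let Xn0 k : tofrac 'X^k != 0.
Proof. by rewrite tofrac_eq0 monic_neq0 ?monicXn. Qed.

Fact laurent_frac1 : laurent_frac 1 0 = 1.
Proof. by rewrite /laurent_frac expr0 divr1 tofrac1. Qed.

Fact laurent_fracB p k p' k' :
  laurent_frac p k - laurent_frac p' k'
    = laurent_frac (p * 'X^k' - p' * 'X^k) (k + k')%N.
Proof.
rewrite /laurent_frac -mulNr addf_div ?Xn0 // exprD !(tofracM, tofracB).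
by rewrite mulNr.
Qed.

Fact laurent_fracM p k p' k' :
  laurent_frac p k * laurent_frac p' k' = laurent_frac (p * p') (k + k')%N.
Proof. by rewrite /laurent_frac mulf_div exprD !tofracM. Qed.

Fact laurent_subring_closed : subring_closed laurent_pred.
Proof.
split=> [|x y /asboolP[p [k ->]] /asboolP[p' [k' ->]]
          |x y /asboolP[p [k ->]] /asboolP[p' [k' ->]]].
- by rewrite -laurent_frac1; exact: laurent_fracP.
- by rewrite laurent_fracB; exact: laurent_fracP.
- by rewrite laurent_fracM; exact: laurent_fracP.
Qed.
HB.instance Definition _ := GRing.SubChoice_isSubComNzRing.Build _ laurent_pred
  laurent laurent_subring_closed.

(* p / q^k *)
Definition lfrac (p : {poly F}) (k : nat) : laurent :=
  Laurent (laurent_fracP p k).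

Definition lconst (c : F) : laurent := lfrac c%:P 0.

(* q ^ e *)
Definition lpow (e : int) : laurent :=
  match e with Posz k => lfrac 'X^k 0 | Negz k => lfrac 1 k.+1 end.

Lemma lfrac_eq p k p' k' :
  (lfrac p k == lfrac p' k') = (p * 'X^k' == p' * 'X^k).
Proof.
by rewrite -val_eqE /= /laurent_frac eqr_div ?Xn0 // -!tofracM tofrac_eq.
Qed.

Lemma lfrac_surj x : exists p k, x = lfrac p k.
Proof.
by have /asboolP[p [k e]] := valP x; exists p, k; apply: val_inj.
Qed.

(* The embedding F[q, q^-1] -> F[v, v^-1], q |-> v^2.  The ring
   F[q^(1/2), q^(-1/2)] is [laurent F] with indeterminate v = q^(1/2), seen as
   an extension of F[q, q^-1] through this map. *)
Definition lsq (x : laurent) : laurent :=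
  let pk := xget (0 : {poly F}, 0%N) [set pk | x = lfrac pk.1 pk.2] in
  lfrac (pk.1 \Po 'X^2) (2 * pk.2)%N.

Lemma lsq_frac p k : lsq (lfrac p k) = lfrac (p \Po 'X^2) (2 * k)%N.
Proof.
rewrite /lsq; case: xgetP => [[p' k'] _ /= e|/(_ (p, k))]; last by case.
have XE j : ('X^(2 * j)%N : {poly F}) = 'X^j \Po 'X^2.
  by rewrite comp_Xn_poly exprM.
move/eqP: e; rewrite lfrac_eq => /eqP e; apply/eqP; rewrite lfrac_eq.
by rewrite !XE -!comp_polyM e.
Qed.

Fact lsq_is_zmod_morphism : zmod_morphism lsq.
Proof.
move=> x y; have [p [k ->]] := lfrac_surj x; have [p' [k' ->]] := lfrac_surj y.
have B a i b j : lfrac a i - lfrac b j = lfrac (a * 'X^j - b * 'X^i) (i + j)%N.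
  by apply: val_inj; rewrite raddfB /= laurent_fracB.
by rewrite !(B, lsq_frac) mulnDr comp_polyB !comp_polyM !comp_Xn_poly -!exprM.
Qed.
Fact lsq_is_monoid_morphism : monoid_morphism lsq.
Proof.
have l1 : lfrac 1 0 = 1 by apply: val_inj; rewrite /= laurent_frac1.
have M a i b j : lfrac a i * lfrac b j = lfrac (a * b) (i + j)%N.
  by apply: val_inj; rewrite rmorphM /= laurent_fracM.
split=> [|x y].
  by rewrite -l1 lsq_frac muln0 comp_polyC.
have [p [k ->]] := lfrac_surj x; have [p' [k' ->]] := lfrac_surj y.
by rewrite !(M, lsq_frac) mulnDr comp_polyM.
Qed.
HB.instance Definition _ := GRing.isZmodMorphism.Build laurent laurent lsq
  lsq_is_zmod_morphism.
HB.instance Definition _ := GRing.isMonoidMorphism.Build laurent laurent lsq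
  lsq_is_monoid_morphism.

End Laurent.

Definition laurent_ring (F : fieldType) : comNzRingType := laurent F.
Notation as_alg T := (AssocAlgebra.clone _ T _) (only parsing).

(* ---------------------------------------------------------------------- *)
(* The symmetric group.  The index [i : 'I_n.-1] stands for the simple
   reflection exchanging the points i and i+1 of {0, ..., n-1}.           *)

Section SymmetricGroup.
Variable n : nat.

Fact lo_subproof (i : 'I_n.-1) : (i < n)%N.
Proof. exact: leq_trans (ltn_ord i) (leq_pred n). Qed.
Fact hi_subproof (i : 'I_n.-1) : (i.+1 < n)%N.
Proof. by have := ltn_ord i; rewrite ltn_predRL. Qed.

Definition lo (i : 'I_n.-1) : 'I_n := Ordinal (lo_subproof i).
Definition hi (i : 'I_n.-1) : 'I_n := Ordinal (hi_subproof i).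

Definition srefl (i : 'I_n.-1) : 'S_n := tperm (lo i) (hi i).

(* The product u v means u after v; MathComp's [(v * u)%g] applies v first. *)
Definition pmul (u v : 'S_n) : 'S_n := (v * u)%g.

Definition word_perm (s : seq 'I_n.-1) : 'S_n :=
  foldr (fun i w => pmul (srefl i) w) 1%g s.

Definition reduced_word (w : 'S_n) (s : seq 'I_n.-1) : Prop :=
  word_perm s = w /\ forall s', word_perm s' = w -> (size s <= size s')%N.

(* a chosen reduced expression *)
Definition redword (w : 'S_n) : seq 'I_n.-1 :=
  xget [::] [set s | reduced_word w s].

Definition len (w : 'S_n) : nat := size (redword w).

End SymmetricGroup.

(* 1 + a + b + ab + ba + aba *)
Definition steinberg (A : pzRingType) (a b : A) : A :=
  1 + a + b + a * b + b * a + a * b * a.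

(* ---------------------------------------------------------------------- *)
(* Iwahori-Hecke and Temperley-Lieb algebras over F[q, q^-1] with parameter
   [q : laurent F], which is either the indeterminate or its image under
   [lsq].                                                                 *)

Section Hecke.
Variables (F : fieldType) (q : laurent F) (n : nat).
Local Notation K := (laurent_ring F).
Local Notation X i := (free_var K (i : 'I_n.-1)).

Inductive hecke_rel : set (free_alg K 'I_n.-1) :=
| hecke_rel_comm (i j : 'I_n.-1) : (i.+1 < j)%N || (j.+1 < i)%N ->
    hecke_rel (X i * X j - X j * X i)
| hecke_rel_braid (i j : 'I_n.-1) : j = i.+1 :> nat ->
    hecke_rel (X i * X j * X i - X j * X i * X j)
| hecke_rel_quad (i : 'I_n.-1) :
    hecke_rel (X i ^+ 2 - (scal q + scal (q - 1) * X i)).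

Definition hecke := quot_alg hecke_rel.
HB.instance Definition _ := AssocAlgebra.on hecke.
HB.instance Definition _ := GRing.Lmodule.on hecke.

Definition hG (i : 'I_n.-1) : hecke := cls (X i).
Definition hGw (w : 'S_n) : hecke := \prod_(i <- redword w) hG i.

(* empty when n <= 2 *)
Definition tl_rel : set hecke :=
  [set x | exists i j : 'I_n.-1,
    [/\ i = 0%N :> nat, j = 1%N :> nat & x = steinberg (hG i) (hG j)]].

Definition tl := quot_alg tl_rel.
HB.instance Definition _ := AssocAlgebra.on tl.
HB.instance Definition _ := GRing.Lmodule.on tl.

End Hecke.

Arguments hG {F} q {n} i.
Arguments hGw {F} q {n} w.

Section HeckeMap.
Variables (F : fieldType) (q q' : laurent F) (m n : nat).
Variable (s : {rmorphism laurent_ring F -> hecke q' n}).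
Variable (f : 'I_m.-1 -> 'I_n.-1).
Hypothesis sC : forall k x, s k * x = x * s k.
Hypothesis sq : s q = scal q'.
Hypothesis f_shift : forall i j : 'I_m.-1, (f i + j = f j + i)%N.

Lemma hecke_mapE (p : free_alg (laurent_ring F) 'I_m.-1) :
  quot_lift (free_eval s (hG q' \o f)) (cls p : hecke q m)
    = free_eval s (hG q' \o f) p.
Proof.
have [e1 eM] : monoid_morphism (free_eval s (hG q' \o f)).
  by apply: free_eval_is_monoid_morphism => *; rewrite sC.
have eB := free_eval_is_zmod_morphism s (hG q' \o f).
apply: quot_liftE => //.
have eX := free_eval_var s (hG q' \o f).
have eS := free_eval_scal s (hG q' \o f).
have eD : {morph free_eval s (hG q' \o f) : x y / x + y} by exact: raddfD.
move: (free_eval s (hG q' \o f)) => e in e1 eM eB eX eS eD *.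
have relE x y : hecke_rel q' (x - y) -> cls x = cls y :> hecke q' n.
  by move/cls_rel; rewrite rmorphB => /eqP; rewrite subr_eq0 => /eqP.
have cM x y : cls (x * y) = cls x * cls y :> hecke q' n by exact: rmorphM.
have cD x y : cls (x + y) = cls x + cls y :> hecke q' n by exact: raddfD.
have eXX x : e (free_var (laurent_ring F) x) = cls (free_var (laurent_ring F) (f x)).
  by rewrite eX.
have sq1 : s (q - 1) = cls (scal (q' - 1)).
  by rewrite cls_scal !rmorphB !rmorph1 sq.
move=> _ [i j ij|i j ij|i]; rewrite eB; apply/eqP; rewrite subr_eq0; apply/eqP.
- rewrite (eM (free_var _ i)) (eM (free_var _ j)) !eXX -!cM.
  apply/relE/hecke_rel_comm.
  by have := f_shift i j; case/orP: ij => ij ?; apply/orP; [left|right]; lia.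
- rewrite (eM (_ * _) (free_var _ i)) (eM (_ * _) (free_var _ j)).
  rewrite (eM (free_var _ i)) (eM (free_var _ j)) !eXX -!cM.
  by apply/relE/hecke_rel_braid; have := f_shift i j; lia.
- rewrite expr2 (eM (free_var _ i)) eD (eM (scal _)) !eS !eXX sq sq1 -!cM
    -cls_scal.
  exact: etrans (relE _ _ (hecke_rel_quad q' (f i))) (cD _ _).
Qed.

End HeckeMap.

(* Extension of scalars along [lsq]: G_i |-> G_i. *)
Definition hecke_ext (F : fieldType) (q : laurent F) (n : nat) :
    hecke q n -> hecke (lsq q) n :=
  quot_lift (free_eval (scal \o @lsq F) (hG (lsq q))).

Lemma hecke_ext_cls (F : fieldType) (q : laurent F) (n : nat) p :
  hecke_ext (cls p : hecke q n) = free_eval (scal \o @lsq F) (hG (lsq q)) p.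
Proof.
pose s : {rmorphism laurent_ring F -> hecke (lsq q) n} := scal \o @lsq F.
apply: (@hecke_mapE F q (lsq q) n n s id) => // *; last exact: addnC.
exact: scal_central.
Qed.

(* ---------------------------------------------------------------------- *)
(* The Yokonuma-Hecke algebra and its quotient FTL.                       *)

Section Yokonuma.
Variables (F : fieldType) (q : laurent F) (d n : nat).
Local Notation K := (laurent_ring F).

Definition dinv : K := lconst d%:R^-1.

(* 1/d sum_s a^s b^-s when b^d = 1, with b^-1 written as b^(d-1) *)
Definition eidem (A : assocAlgType K) (a b : A) : A :=
  scal dinv * \sum_(s < d) a ^+ s * (b ^+ d.-1) ^+ s.

Definition ygen : choiceType := ('I_n.-1 + 'I_n)%type.
Local Notation g i := (free_var K (inl (i : 'I_n.-1) : ygen)).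
Local Notation t j := (free_var K (inr (j : 'I_n) : ygen)).

Inductive yh_rel : set (free_alg K ygen) :=
| yh_rel_comm (i j : 'I_n.-1) : (i.+1 < j)%N || (j.+1 < i)%N ->
    yh_rel (g i * g j - g j * g i)
| yh_rel_braid (i j : 'I_n.-1) : j = i.+1 :> nat ->
    yh_rel (g i * g j * g i - g j * g i * g j)
| yh_rel_tcomm (i j : 'I_n) : yh_rel (t i * t j - t j * t i)
| yh_rel_tg (i : 'I_n.-1) (j : 'I_n) : yh_rel (t j * g i - g i * t (srefl i j))
| yh_rel_tpow (j : 'I_n) : yh_rel (t j ^+ d - 1)
| yh_rel_quad (i : 'I_n.-1) :
    yh_rel (g i ^+ 2 -
            (scal q + scal (q - 1) * eidem (t (lo i)) (t (hi i)) * g i)).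

Definition yh := quot_alg yh_rel.
HB.instance Definition _ := AssocAlgebra.on yh.
HB.instance Definition _ := GRing.Lmodule.on yh.

Definition yg (i : 'I_n.-1) : yh := cls (g i).
Definition yt (j : 'I_n) : yh := cls (t j).
Definition ye (i : 'I_n.-1) : yh := eidem (yt (lo i)) (yt (hi i)).
Definition ygw (w : 'S_n) : yh := \prod_(i <- redword w) yg i.

(* empty when n <= 2 *)
Definition ftl_rel : set yh :=
  [set x | exists i j : 'I_n.-1,
    [/\ i = 0%N :> nat, j = 1%N :> nat
      & x = ye i * ye j * steinberg (yg i) (yg j)]].

Definition ftl := quot_alg ftl_rel.
HB.instance Definition _ := AssocAlgebra.on ftl.
HB.instance Definition _ := GRing.Lmodule.on ftl.

(* A character chi of A_{d,n} is given by the d-th roots of unity chi(t_j). *)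
Definition Echi (chi : 'I_n -> F) : yh :=
  \prod_(j < n) (scal dinv *
    \sum_(s < d) scal (lconst (chi j ^+ s)) * (yt j ^+ d.-1) ^+ s).

Definition char_act (w : 'S_n) (chi : 'I_n -> F) : 'I_n -> F :=
  fun j => chi ((w^-1)%g j).

End Yokonuma.

Arguments ygw {F} q d {n} w.
Arguments Echi {F} q d {n} chi.
Arguments yg {F} q d {n} i.
Arguments yt {F} q d {n} j.

(* Extension of scalars along [lsq]: g_i |-> g_i, t_j |-> t_j. *)
Definition yh_ext (F : fieldType) (q : laurent F) (d n : nat) :
    yh q d n -> yh (lsq q) d n :=
  quot_lift (free_eval (fun k => scal (lsq k))
    (fun x : ygen n => match x with
                       | inl i => yg (lsq q) d i
                       | inr j => yt (lsq q) d j
                       end)).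

(* ---------------------------------------------------------------------- *)
(* Compositions of n with d (possibly zero) parts.                        *)

Definition composition (d n : nat) :=
  {mu : {ffun 'I_d -> 'I_n.+1} | (\sum_(i < d) mu i == n)%N}.

Section Composition.
Variables (d n : nat) (mu : composition d n).

Definition part (i : 'I_d) : nat := val mu i.
Definition psum (k : nat) : nat := (\sum_(i < d | i < k) part i)%N.

Lemma psum_part_le (i : 'I_d) : (psum i + part i <= n)%N.
Proof.
rewrite -[leqRHS](eqP (valP mu)) [leqRHS](bigD1 i) //= addnC leq_add2l /psum.
rewrite big_mkcond [leqRHS]big_mkcond; apply: leq_sum => l _.
by case: ltnP => // li; rewrite neq_ltn li.
Qed.

Definition Jset : {set 'I_n.-1} :=
  [set j : 'I_n.-1 | [forall k : 'I_d, (0 < k)%N ==> (j.+1 != psum k)]]%SET.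

Definition young : {group 'S_n} := <<(@srefl n @: Jset)%SET>>%G.

Definition m_mu : nat := (n`! %/ \prod_(i < d) (part i)`!)%N.

(* [pi] enumerates the minimal length representatives of the left cosets
   w S_mu, starting with 1. *)
Definition min_coset_reps (pi : 'I_m_mu -> 'S_n) : Prop :=
  [/\ forall w, exists! k, pmul (pi k)^-1%g w \in young,
      forall k u, u \in young -> (len (pi k) <= len (pmul (pi k) u))%N
    & forall k : 'I_m_mu, k = 0%N :> nat -> pi k = 1%g].

Fact block_gen_subproof (i : 'I_d) (j : 'I_(part i).-1) :
  (psum i + j < n.-1)%N.
Proof.
have := ltn_ord j; rewrite !ltn_predRL => ji.
by rewrite -addnS; apply: leq_trans (psum_part_le i); rewrite ltn_add2l.
Qed.
(* position in {0, ..., n-1} of the j-th generator of the i-th block *)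
Definition block_gen (i : 'I_d) (j : 'I_(part i).-1) : 'I_n.-1 :=
  Ordinal (block_gen_subproof j).

Section BlockAlgebras.
Variables (F : fieldType) (q : laurent F).

Definition hecke_mu : Type :=
  sub_alg [set x : hecke q n | exists2 j, j \in Jset & x = hG q j].
HB.instance Definition _ := AssocAlgebra.on hecke_mu.
HB.instance Definition _ := GRing.Lmodule.on hecke_mu.

Definition tl_mu : Type := tens_alg (fun i : 'I_d => as_alg (tl q (part i))).
HB.instance Definition _ := AssocAlgebra.on tl_mu.
HB.instance Definition _ := GRing.Lmodule.on tl_mu.

Definition mat_hecke_mu : Type := mat_alg (as_alg hecke_mu) m_mu.
HB.instance Definition _ := AssocAlgebra.on mat_hecke_mu.
HB.instance Definition _ := GRing.Lmodule.on mat_hecke_mu.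

Definition mat_tl_mu : Type := mat_alg (as_alg tl_mu) m_mu.
HB.instance Definition _ := AssocAlgebra.on mat_tl_mu.
HB.instance Definition _ := GRing.Lmodule.on mat_tl_mu.

(* the embedding of H_{mu_i} as the i-th factor of H^mu *)
Definition block_shift (i : 'I_d) : hecke q (part i) -> hecke q n :=
  quot_lift (free_eval scal (fun j => hG q (block_gen j))).

Lemma block_shift_cls (i : 'I_d) p :
  block_shift (cls p : hecke q (part i))
    = free_eval scal (fun j => hG q (block_gen j)) p.
Proof.
apply: (@hecke_mapE F q q (part i) n scal (@block_gen i)) => [k x||j l] //.
  exact: scal_central.
by rewrite /= addnAC.
Qed.

(* The identification H^mu = H_{mu_1} ⊗ ... ⊗ H_{mu_d} sends the pure tensor
   a_1 ⊗ ... ⊗ a_d to the product of the images of the a_i in H_n. *)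
Definition is_rho (rho : hecke_mu -> tl_mu) : Prop :=
  linear rho /\
  forall (a : forall i, hecke q (part i)) (x : hecke_mu),
    val x = \prod_(i < d) block_shift (a i) ->
    rho x = pure_tensor (fun i => cls (a i) : tl q (part i)).

End BlockAlgebras.

Section Idempotent.
Variables (F : fieldType) (xi : 'I_d -> F) (pi : 'I_m_mu -> 'S_n).

(* xi_i for the unique block i containing the point j *)
Definition chi1 (j : 'I_n) : F :=
  if [pick i : 'I_d | (psum i <= j < psum i.+1)%N] is Some i then xi i else 0.

Definition chi_mu (k : 'I_m_mu) : 'I_n -> F := char_act (pi k) chi1.

Definition E_mu (q : laurent F) : yh q d n :=
  \sum_(k < m_mu) Echi q d (chi_mu k).

Variable q : laurent F.
Local Notation qv := (lsq q).

(* U_mu for e = 1 and its inverse for e = -1; [lpow] is a power of q^(1/2) *)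
Definition U_mat (e : int) : 'M[hecke qv n]_m_mu :=
  \matrix_(k, l)
    (if k == l then scal (lpow F (e * (len (pi k))%:Z)) else 0).

Definition is_tPsi (tPsi : corner (E_mu qv) -> mat_hecke_mu qv) :
    Prop :=
  linear tPsi /\
  forall (k l : 'I_m_mu) (w : 'S_n), char_act w (chi_mu l) =1 chi_mu k ->
    let u := pmul (pmul (pi k)^-1%g w) (pi l) in
    map_mx val (tPsi (corner_proj (E_mu qv) (Echi qv d (chi_mu k) * ygw qv d w)))
      = (scal (lpow F ((len w)%:Z - (len u)%:Z)) * hGw qv u) *: delta_mx k l.

Definition is_Psi (tPsi : corner (E_mu qv) -> mat_hecke_mu qv)
    (Psi : corner (E_mu q) -> mat_hecke_mu q) : Prop :=
  forall x : corner (E_mu q),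
    map_mx (fun a => hecke_ext (val a)) (Psi x) =
    U_mat 1 *m map_mx val (tPsi (corner_proj (E_mu qv) (yh_ext (val x))))
            *m U_mat (- 1).

Definition E_mu_ftl : ftl q d n := cls (E_mu q).

Definition theta_mu : corner (E_mu q) -> corner E_mu_ftl :=
  fun x => corner_map (@cls _ (@ftl_rel F q d n)) x.

Definition is_psi (rho : hecke_mu q -> tl_mu q)
    (Psi : corner (E_mu q) -> mat_hecke_mu q)
    (psi : corner E_mu_ftl -> mat_tl_mu q) : Prop :=
  alg_hom_for psi (@corner_mul _ _ _) (corner_one _) *%R 1 /\
  forall x, psi (theta_mu x) = map_mx rho (Psi x).

Definition is_phi (rho : hecke_mu q -> tl_mu q)
    (Phi : mat_hecke_mu q -> corner (E_mu q))
    (phi : mat_tl_mu q -> corner E_mu_ftl) : Prop :=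
  alg_hom_for phi *%R 1 (@corner_mul _ _ _) (corner_one _) /\
  forall x, phi (map_mx rho x) = theta_mu (Phi x).

End Idempotent.

End Composition.

(* ---------------------------------------------------------------------- *)
(* The direct sums of the maps psi_mu and phi_mu.                         *)

Section DirectSumMaps.
Variables (F : fieldType) (q : laurent F) (d n : nat) (xi : 'I_d -> F).
Variable pi : forall mu : composition d n, 'I_(m_mu mu) -> 'S_n.

Definition mat_sum : Type :=
  dsum_alg (fun mu : composition d n => as_alg (mat_tl_mu mu q)).
HB.instance Definition _ := AssocAlgebra.on mat_sum.
HB.instance Definition _ := GRing.Lmodule.on mat_sum.

(* E_mu FTL *)
Definition ftl_block (mu : composition d n) : Type :=
  corner (E_mu_ftl xi (@pi mu) q).
HB.instance Definition _ mu := GRing.Lmodule.on (ftl_block mu).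

Definition psi_sum
    (psi : forall mu, ftl_block mu -> mat_tl_mu mu q) :
    ftl q d n -> mat_sum :=
  fun x mu => psi mu (corner_proj _ x).

Definition phi_sum
    (phi : forall mu, mat_tl_mu mu q -> ftl_block mu) :
    mat_sum -> ftl q d n :=
  fun M => \sum_(mu : composition d n) val (phi mu (M mu)).

End DirectSumMaps.

(* Main.v *)
(** The identities [psi o theta = rho o Psi] and [phi o rho = theta o Phi] make
    [psi] and [phi] mutually inverse as soon as [theta] and the entrywise [rho]
    are onto; [rho] is onto because every pure tensor is in its image.  For the
    direct sum one needs the [E_mu] to be orthogonal with sum 1.  The [E_chi]
    are eigenvectors of multiplication by each [t_j^-1], with eigenvalue
    [chi(t_j)^-1], hence orthogonal, and the sum of all of them factors as a
    product over [j] of sums equal to 1.  The characters [chi_k^mu] exhaust all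
    characters without repetition: they are the words in the alphabet
    {1, ..., d}, [mu] being the content of the word and [k] the coset of
    permutations carrying the sorted word to it, since the stabiliser of the
    sorted word is the Young subgroup. *)

Require Import Defs.
From HB Require Import structures.
From mathcomp Require Import all_boot all_order all_algebra all_fingroup.
From mathcomp Require Import finmap boolp classical_sets reals complex monalg.
From mathcomp Require Import zify.

Set Implicit Arguments.
Unset Strict Implicit.
Unset Printing Implicit Defensive.

Import GRing.Theory.
Local Open Scope ring_scope.

(** * Blocks of a composition and the Young subgroup *)

Section Blocks.
Variables (d n : nat) (mu : composition d n).
Local Notation psum := (psum mu).
Local Notation part := (part mu).

Lemma psum0 : psum 0 = 0%N.
Proof. by rewrite /Defs.psum big_pred0. Qed.

Lemma psumS (i : 'I_d) : psum i.+1 = (psum i + part i)%N.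
Proof.
rewrite /Defs.psum (bigD1 i) //= addnC; congr (_ + _)%N.
by apply: eq_bigl => l; rewrite ltnS ltn_neqAle andbC.
Qed.

Lemma psum_total : psum d = n.
Proof. by rewrite -[RHS](eqP (valP mu)); apply: eq_bigl => i; rewrite ltn_ord. Qed.

Lemma leq_psum : {homo psum : k l / (k <= l)%N}.
Proof.
move=> k l kl; rewrite /Defs.psum big_mkcond [leqRHS]big_mkcond.
apply: leq_sum => i _; case: ltnP => // ik.
by rewrite (leq_trans ik kl).
Qed.

Definition in_block (i : 'I_d) (j : nat) := (psum i <= j < psum i.+1)%N.

Lemma block_exists (j : 'I_n) : exists i : 'I_d, in_block i j.
Proof.
(* Take the least [k] with [j < psum k]: it is positive because [psum 0 = 0], and its predecessor is
   the block of [j]. *)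
have : exists k, (j < psum k)%N by exists d; rewrite psum_total.
move/ex_minnP => [k jk kmin].
case: k jk kmin => [|k] jk kmin; first by rewrite psum0 in jk.
have kd : (k < d)%N by apply: kmin; rewrite psum_total.
exists (Ordinal kd); rewrite /in_block jk andbT leqNgt.
by apply/negP => /kmin; rewrite ltnn.
Qed.

Lemma in_block_inj (i l : 'I_d) (j : nat) : in_block i j -> in_block l j -> i = l.
Proof.
move=> /andP[i1 i2] /andP[l1 l2]; apply: val_inj => /=.
by case: (ltngtP i l) => // [/leq_psum|/leq_psum]; lia.
Qed.

Definition block (j : 'I_n) : 'I_d := xchoose (block_exists j).

Lemma blockP (j : 'I_n) : in_block (block j) j.
Proof. exact: (xchooseP (block_exists j)). Qed.

Lemma block_eq (i : 'I_d) (j : 'I_n) : (block j == i) = in_block i j.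
Proof.
apply/eqP/idP => [<-|ij]; first exact: blockP.
exact: in_block_inj (blockP j) ij.
Qed.

Lemma card_block (i : 'I_d) : #|[set j | block j == i]%SET| = part i.
Proof.
rewrite -sum1_card (eq_bigl (in_block i \o val)) => [/=|j]; last first.
  by rewrite inE block_eq.
rewrite -(big_mkord (in_block i) (fun=> 1%N)).
have le := psum_part_le mu i; have S := psumS i.
rewrite (@big_cat_nat _ _ _ (psum i)) ?leq_trans // /=; last lia.
rewrite (@big_cat_nat _ _ _ (psum i.+1) (psum i)) /=; [|lia..].
rewrite big_nat_cond big_pred0 => [|j]; last by rewrite /in_block; lia.
rewrite add0n big_nat_cond (eq_bigl (fun j => psum i <= j < psum i.+1)%N) => [|j].
  rewrite -big_nat sum_nat_const_nat muln1.
  rewrite big_nat_cond big_pred0 => [|j]; last by rewrite /in_block; lia.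
  by rewrite addn0 S addKn.
by rewrite /in_block; lia.
Qed.

(** The stabiliser of the sorted word [block]; identified below with the Young subgroup, so that
    membership can be tested pointwise. *)
Definition block_stab := [set w : 'S_n | [forall j, block (w j) == block j]]%SET.

Fact block_stab_group_set : group_set block_stab.
Proof.
apply/group_setP; split=> [|u v].
  by rewrite inE; apply/forallP => j; rewrite perm1.
rewrite !inE => /forallP uP /forallP vP; apply/forallP => j.
by rewrite permM (eqP (vP _)) (eqP (uP _)).
Qed.
Canonical block_stab_group := Group block_stab_group_set.

Lemma block_stabP (w : 'S_n) :
  reflect (forall j, block (w j) = block j) (w \in block_stab).
Proof. by rewrite inE; apply: (iffP forallP) => wP j; apply/eqP; rewrite wP. Qed.

(** Consecutive points lie in different blocks exactly when a partial sum separates them. *)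
Lemma Jset_block (i : 'I_n.-1) : (i \in Jset mu) = (block (lo i) == block (hi i)).
Proof.
rewrite eq_sym block_eq inE; have /andP[] := blockP (lo i); have := ltn_ord (hi i).
rewrite /in_block /=; set l := block (lo i) => i_n li il.
apply/forallP/andP => [iJ|[_ il'] k]; last first.
  apply/implyP => k0; apply/eqP => ik.
  by case: (leqP k l) => [/leq_psum|/leq_psum]; lia.
split; first by lia.
(* [Jset] tests only partial sums of index below [d]; the end of the last block is [n], which no
   [hi i] reaches. *)
case: (ltnP l.+1 d) => ld; last first.
  have -> : l.+1 = d by apply/eqP; rewrite eqn_leq ld andbT ltn_ord.
  by rewrite psum_total.
have := iJ (Ordinal ld) => /= /eqP. lia.
Qed.

Lemma young_sub_block_stab : young mu \subset block_stab.
Proof.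
rewrite gen_subG; apply/fintype.subsetP => _ /finset.imsetP[i + ->].
rewrite Jset_block => /eqP ij.
by apply/block_stabP => j; rewrite /srefl; case: tpermP => // ->.
Qed.

(** The transposition of [x] and [y] is the conjugate of that of [x] and [y - 1] by a simple
    reflection, and [y - 1] is in the same block because blocks are intervals. *)
Lemma tperm_young (x y : 'I_n) : (x < y)%N -> block x = block y ->
  tperm x y \in young mu.
Proof.
move: {2}(y : nat) (leqnn y) => m; elim: m y => [|m IHm] y; first lia.
move=> ym xy bxy; have y0 : (y.-1 < n.-1)%N by have := ltn_ord y; lia.
pose i : 'I_n.-1 := Ordinal y0.
have hiE : hi i = y by apply: val_inj => /=; lia.
have bx := blockP x; have by' := blockP y; rewrite bxy in bx.
have bi : block (lo i) = block y.
  by apply/eqP; rewrite block_eq; move: bx by'; rewrite /in_block /=; lia.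
have iY : srefl i \in young mu.
  by apply/mem_gen/imset_f; rewrite Jset_block hiE bi.
have [xi|xi] := eqVneq x (lo i).
  by rewrite xi -hiE.
have -> : tperm x y = (tperm x (lo i) ^ srefl i)%g.
  rewrite tpermJ /srefl tpermL hiE tpermD //; last by rewrite neq_ltn xy orbT.
  by rewrite eq_sym.
rewrite groupJ // IHm ?bi //=; first lia.
by move: xi; rewrite -val_eqE /=; lia.
Qed.

(** Induction on the number of moved points: if [w] moves [x], following [w] by the transposition of
    [x] and [w x], which is in the Young subgroup, fixes [x] and moves no new point. *)
Lemma block_stabE : block_stab = young mu.
Proof.
apply/eqP; rewrite finset.eqEsubset young_sub_block_stab andbT.
apply/fintype.subsetP => w.
move: {2}#|_| (leqnn #|[set x | w x != x]%SET|) => m.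
elim: m w => [|m IHm] w le wS.
  rewrite (_ : w = 1%g) ?group1 //; apply/permP => x; rewrite perm1.
  by move: le; rewrite leqn0 cards_eq0 => /eqP/setP/(_ x); rewrite !inE => /negbFE/eqP.
have [/forallP w1|] := boolP [forall x, w x == x].
  by rewrite (_ : w = 1%g) ?group1 //; apply/permP => x; rewrite perm1 (eqP (w1 x)).
rewrite negb_forall => /existsP[x wx].
have tY : tperm x (w x) \in young mu.
  have bx : block x = block (w x) by rewrite (block_stabP _ wS).
  move: wx; rewrite neq_ltn => /orP[] lt; last exact: tperm_young.
  by rewrite tpermC tperm_young.
rewrite -(groupMr w tY); apply: IHm; last first.
  by rewrite groupMr // (fintype.subsetP young_sub_block_stab).
rewrite -ltnS; apply: leq_trans le; apply: proper_card; apply/properP; split.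
  apply/fintype.subsetP => z; rewrite !inE; apply: contraNN => /eqP wz.
  rewrite permM wz tpermD //; apply/eqP => zz; first by rewrite zz wz eqxx in wx.
  by move/negP: wx; apply; apply/eqP/(@perm_inj _ w); rewrite zz.
by exists x; rewrite !inE // permM tpermR eqxx.
Qed.

End Blocks.

Lemma block_content_inj (d n : nat) (mu nu : composition d n) :
  (forall i, #|[set j | block mu j == i]%SET| = #|[set j | block nu j == i]%SET|) ->
  mu = nu.
Proof.
move=> e; apply: val_inj; apply/ffunP => i; apply: val_inj.
by have := e i; rewrite !card_block.
Qed.

(** Equal fibre sizes make the value lists of [f] and [h] equal as multisets. *)
Lemma fibres_conj (d n : nat) (f h : 'I_n -> 'I_d) :
  (forall i, #|[set j | f j == i]%SET| = #|[set j | h j == i]%SET|) ->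
  exists w : 'S_n, forall j, f (w j) = h j.
Proof.
move=> fh.
have /tuple_permP[w wP] : perm_eq (mktuple h) (mktuple f).
  have e (g : 'I_n -> 'I_d) i :
      count_mem i (mktuple g) = #|[set j | g j == i]%SET|.
    rewrite -sum1_count big_map -sum1_card big_enum_cond.
    by apply: eq_bigl => j; rewrite inE.
  by apply/allP => i _; rewrite /= !e fh.
exists w => j.
have := congr1 (fun s : seq _ => nth (h j) s j) wP.
have nm g : nth (h j) (mktuple g) j = g j by rewrite -(tnth_nth _ (mktuple g)) tnth_mktuple.
by rewrite /= nm (nm (fun i => tnth (mktuple f) (w i))) tnth_mktuple.
Qed.

(** * Words indexed by compositions and cosets *)

Section ColourWords.
Variables (d n : nat) (pi : forall mu : composition d n, 'I_(m_mu mu) -> 'S_n).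
Hypothesis pi_reps : forall mu, min_coset_reps (@pi mu).

(** The sorted word of content [mu] moved by a coset representative; composing it with [xi] gives
    [chi_mu]. *)
Definition rep_word (x : {mu : composition d n & 'I_(m_mu mu)}) :
    {ffun 'I_n -> 'I_d} :=
  [ffun j => block (tag x) ((@pi (tag x) (tagged x))^-1%g j)].

(** The letter counts recover [mu]; two representatives giving the same word then differ by a
    stabiliser of the sorted word, so they lie in one coset. *)
Lemma rep_word_inj : injective rep_word.
Proof.
move=> [mu k] [nu l] /ffunP e.
have {}e j : block mu ((@pi mu k)^-1%g j) = block nu ((@pi nu l)^-1%g j).
  by have := e j; rewrite !ffunE.
have card_conj (ka : composition d n) (w : 'S_n) i :
    #|[set j | block ka (w j) == i]%SET| = #|[set j | block ka j == i]%SET|.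
  rewrite -[RHS](card_preimset _ (@perm_inj _ w)).
  by apply: eq_card => j; rewrite !inE.
have mn : mu = nu.
  apply: block_content_inj => i.
  rewrite -(card_conj mu (@pi mu k)^-1%g) -[RHS](card_conj nu (@pi nu l)^-1%g).
  by apply: eq_card => j; rewrite !inE e.
case: nu / mn l e => l e; congr (Tagged _ _).
have [/(_ (@pi mu k))[k' [_ kU]] _ _] := pi_reps mu.
rewrite -(kU k) ?(kU l) // /pmul -block_stabE; apply/block_stabP => j.
  by rewrite permM -e permK.
by rewrite permM permK.
Qed.

(** [mu] is read off the letter counts of [f], [w] carries the sorted word to [f], and [k] is the
    coset of [w]. *)
Lemma rep_word_surj (f : {ffun 'I_n -> 'I_d}) : exists x, rep_word x = f.
Proof.
have le i : (#|[set j | f j == i]%SET| < n.+1)%N.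
  by rewrite ltnS -[leqRHS]card_ord max_card.
pose m : {ffun 'I_d -> 'I_n.+1} := [ffun i => Ordinal (le i)].
have mP : (\sum_(i < d) m i == n)%N.
  rewrite -[X in _ == X]card_ord -sum1_card (partition_big f predT) //=.
  by apply/eqP/eq_bigr => i _; rewrite ffunE /= -sum1_card; apply: eq_bigl => j; rewrite inE.
pose mu : composition d n := Sub m mP.
have [w wP] : exists w : 'S_n, forall j, f (w j) = block mu j.
  by apply: fibres_conj => i; rewrite card_block /part /= ffunE.
have [/(_ w)[k [kP _]] _ _] := pi_reps mu.
exists (Tagged (fun mu => 'I_(m_mu mu)) k); apply/ffunP => j; rewrite ffunE /=.
move: kP; rewrite -block_stabE => /block_stabP/(_ (w^-1%g j)).
by rewrite /pmul permM permKV => ->; rewrite -wP permKV.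
Qed.

End ColourWords.

(** * Generators of free, tensor and sub-algebras; surjectivity of rho *)

Section FreeAlgebraSpan.
Variables (K : comNzRingType) (X : choiceType).

Lemma free_algE (p : free_alg K X) :
  p = \sum_(m <- msupp p) scal (mcoeff m p) * \prod_(x <- (m : seq X)) free_var K x.
Proof.
have addE (x y : free_alg K X) : x + y = (x : {malg K[{fmonom X}]}) + (y : {malg K[{fmonom X}]}).
  by transitivity (free_add x y); rewrite // free_add.unlock.
have monE (m : {fmonom X}) : \prod_(x <- (m : seq X)) free_var K x = mkmalgU m 1.
  case: m => m; elim: m => [|x m IHm] /=.
    rewrite big_nil; transitivity (free_scal X (1 : K)) => //.
    by rewrite free_scal.unlock; congr (mkmalgU _ _); apply: val_inj; rewrite /= fm1.
  rewrite big_cons IHm free_mulE free_var.unlock malgM_def fgmulUU mulr1.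
  by congr (mkmalgU _ _); apply: val_inj => /=; rewrite ?fmM ?fmU.
have sumE (s : seq {fmonom X}) (G : {fmonom X} -> free_alg K X) :
    \sum_(m <- s) G m = \sum_(m <- s) (G m : {malg K[{fmonom X}]}).
  elim: s => [|m s IHs]; last by rewrite !big_cons IHs addE.
  rewrite !big_nil; transitivity (free_scal X (0 : K)) => //.
  by rewrite free_scal.unlock malgC0E.
rewrite {1}[p]monalgE sumE; apply: eq_bigr => m _.
rewrite monE free_mulE -[scal _]/(free_scal _ _) free_scal.unlock.
by rewrite malgM_def fgmulUU mul1m mulr1.
Qed.

End FreeAlgebraSpan.

Section PullFactor.
Variables (B : pzRingType) (I : eqType).

(** Without commutativity, [c] can still be moved to position [i] if it commutes with all other
    factors. This serves both pure tensors and the action of [t_j^-1] on [Echi]. *)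
Lemma mul_prod_at (c : B) (F G : I -> B) (i : I) (s : seq I) :
  uniq s -> i \in s -> (forall j, j != i -> G j = F j /\ c * F j = F j * c) ->
  G i = c * F i -> c * \prod_(j <- s) F j = \prod_(j <- s) G j.
Proof.
move=> + + FG Gi; elim: s => [|j s IHs] //= /andP[js us].
rewrite in_cons !big_cons; have [ij _|ij /= si] := eqVneq i j.
  rewrite -{}ij in js *.
  rewrite Gi mulrA; congr (_ * _).
  elim: s js {IHs us} => [|l t IHt]; first by rewrite !big_nil.
  rewrite in_cons negb_or => /andP[il /IHt]; rewrite !big_cons => ->.
  by rewrite (proj1 (FG l _)) // eq_sym.
have [Gj cj] := FG j (ltac:(by rewrite eq_sym)).
by rewrite mulrA cj -mulrA IHs // Gj.
Qed.

End PullFactor.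

Section PureTensors.
Variables (K : comNzRingType) (m : nat) (A : 'I_m -> assocAlgType K).

Lemma tens_inM i (a b : A i) : tens_in (a * b) = tens_in a * tens_in b.
Proof.
apply/eqP; rewrite -subr_eq0 -rmorphM -rmorphB; apply/eqP/cls_rel.
exact: tens_rel_mul.
Qed.

Lemma tens_in1 i : tens_in (1 : A i) = 1.
Proof.
rewrite -(rmorph1 (@scal K (A i))); transitivity (cls (scal 1) : tens_alg A).
  by apply/eqP; rewrite -subr_eq0 -rmorphB; apply/eqP/cls_rel/tens_rel_scal.
by rewrite !rmorph1.
Qed.

Lemma tens_inC i j (a : A i) (b : A j) :
  i != j -> tens_in a * tens_in b = tens_in b * tens_in a.
Proof.
move=> ij; apply/eqP; rewrite -subr_eq0 -!rmorphM -rmorphB.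
by apply/eqP/cls_rel/tens_rel_comm.
Qed.

Lemma tens_in_pure i (a : A i) (b : forall j, A j) :
  tens_in a * pure_tensor b = pure_tensor (dfwith b (a * b i)).
Proof.
rewrite /pure_tensor; apply: (@mul_prod_at _ _ _ _ _ i) => //=.
- exact: index_enum_uniq.
- exact: mem_index_enum.
- by move=> j ji; rewrite dfwith_out // 1?eq_sym //; split=> //; apply: tens_inC; rewrite eq_sym.
- by rewrite dfwith_in tens_inM.
Qed.

(** By [tens_in_pure], a word in the generators collapses letter by letter into one pure tensor,
    starting from the tensor of units. *)
Lemma pure_tensor_span (y : tens_alg A) :
  exists (I : Type) (s : seq I) (c : I -> K) (b : I -> forall i, A i),
    y = \sum_(k <- s) c k *: pure_tensor (b k).
Proof.
have [p ->] := cls_surj y.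
have mon (s : seq {i : 'I_m & A i}) :
    exists b, cls (\prod_(x <- s) free_var K x) = pure_tensor b.
  elim: s => [|[i a] s [b IHs]].
    exists (fun=> 1); rewrite big_nil rmorph1 /pure_tensor big1 // => i _.
    exact: tens_in1.
  exists (dfwith b (a * b i)); rewrite big_cons -tens_in_pure -IHs.
  exact: rmorphM.
have [b bP] := choice mon.
exists _, (msupp p : seq _), (fun m => mcoeff m p), (fun m : {fmonom _} => b (fmonom_val m)).
rewrite {1}[p]free_algE raddf_sum; apply: eq_bigr => k _.
rewrite -bP -[RHS]/(scal _ * _) -cls_scal; exact: rmorphM.
Qed.

End PureTensors.

Section SubalgebraClosure.
Variables (K : comNzRingType) (B : assocAlgType K) (S : set B).

Lemma gen_subalg_mul x y :
  x \in gen_subalg S -> y \in gen_subalg S -> x * y \in gen_subalg S.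
Proof. by have [_ _] := gen_subalg_subring_closed S; apply. Qed.

Lemma gen_subalg_sum (I : Type) (s : seq I) (G : I -> B) :
  (forall i, G i \in gen_subalg S) -> \sum_(i <- s) G i \in gen_subalg S.
Proof.
move=> GS; have [S1 SB _] := gen_subalg_subring_closed S.
have S0 : 0 \in gen_subalg S by rewrite -(subrr 1) SB.
elim: s => [|i s IHs]; first by rewrite big_nil.
by rewrite big_cons -[\sum_(_ <- s) _]opprK -[- \sum_(_ <- s) _]sub0r !SB.
Qed.

Lemma gen_subalg_prod (I : Type) (s : seq I) (G : I -> B) :
  (forall i, G i \in gen_subalg S) -> \prod_(i <- s) G i \in gen_subalg S.
Proof.
move=> GS; have [S1 _ _] := gen_subalg_subring_closed S.
elim: s => [|i s IHs]; first by rewrite big_nil.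
by rewrite big_cons gen_subalg_mul.
Qed.

End SubalgebraClosure.

Section RhoSurjective.
Variables (d n : nat) (mu : composition d n) (F : fieldType) (q : laurent F).

(** The index plus one lies strictly between two consecutive partial sums. *)
Lemma block_gen_Jset (i : 'I_d) (j : 'I_(part mu i).-1) : block_gen j \in Jset mu.
Proof.
rewrite inE; apply/forallP => k; apply/implyP => k0 /=.
have := ltn_ord j.
move=> ji; have S := psumS mu i; apply/eqP; case: (leqP k i) => /(leq_psum mu); lia.
Qed.

Local Notation Jgens := ([set x : hecke q n | exists2 j, j \in Jset mu & x = hG q j]%classic).

Lemma block_shift_subalg (i : 'I_d) (a : hecke q (part mu i)) :
  block_shift a \in gen_subalg Jgens.
Proof.
have [p ->] := cls_surj a; rewrite block_shift_cls /free_eval.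
apply: gen_subalg_sum => m; apply: gen_subalg_mul; first exact: gen_subalg_scal.
apply: gen_subalg_prod => j; apply/asboolP => P _; apply.
by exists (block_gen j) => //; exact: block_gen_Jset.
Qed.

Lemma rho_surj (rho : hecke_mu mu q -> tl_mu mu q) :
  is_rho rho -> forall y, exists x, rho x = y.
Proof.
move=> [rhoL rhoP] y; have [I [s [c [b ->]]]] := pure_tensor_span y.
have pure k : exists x, rho x = pure_tensor (b k).
  (* Lift each tensor factor to its Hecke algebra; the product of the block images is the preimage
     that [is_rho] describes. *)
  pose a i := sval (cid (cls_surj (b k i))).
  have xP : \prod_(i < d) block_shift (a i) \in gen_subalg Jgens.
    by apply: gen_subalg_prod => i; exact: block_shift_subalg.
  exists (SubAlg xP); rewrite (rhoP a) //.
  congr pure_tensor; apply: functional_extensionality_dep => i.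
  by rewrite -(svalP (cid (cls_surj (b k i)))).
have [x xP] := choice pure.
elim: s => [|k s [z zP]].
  exists 0; rewrite big_nil.
  by have := rhoL (-1) 0 0; rewrite scaler0 addr0 scaleN1r addNr.
by exists (c k *: x k + z); rewrite big_cons rhoL xP zP.
Qed.

End RhoSurjective.

(** * The idempotents of the characters *)

Section RootsOfUnity.
Variables (F : fieldType) (d : nat) (xi : 'I_d -> F).
Hypotheses (xi_inj : injective xi) (xi_root : forall i, xi i ^+ d = 1).

(** [X^d - 1] has at most [d] roots in a field, and [xi] already supplies [d] distinct ones. *)
Lemma roots_exhaust (x : F) : (0 < d)%N -> x ^+ d = 1 -> x \in codom xi.
Proof.
move=> d0 xd; apply: contraT => xC.
have : (size (x :: codom xi) <= d)%N.
  apply: max_unity_roots => //=; last by rewrite xC (map_inj_uniq xi_inj) enum_uniq.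
  apply/andP; split; first by rewrite unity_rootE xd.
  by apply/allP => _ /codomP[i ->]; rewrite unity_rootE xi_root.
by rewrite /= size_codom card_ord ltnn.
Qed.

(** For [0 < s < d], the [d] roots cannot all satisfy [X^s = 1]. Multiplying by some [xi i] with
    [xi i ^+ s != 1] permutes the roots and scales the sum by [xi i ^+ s], so the sum vanishes. *)
Lemma sum_rootsX (s : 'I_d) :
  \sum_i xi i ^+ s = if s == 0%N :> nat then d%:R else 0.
Proof.
case: eqP => [-> | /eqP s0].
  by under eq_bigr do rewrite expr0; rewrite sumr_const card_ord.
have d0 : (0 < d)%N := leq_ltn_trans (leq0n s) (ltn_ord s).
have [i is1] : exists i, xi i ^+ s != 1.
  apply/existsP; rewrite -negb_forall; apply/negP => /forallP xs.
  have : (size (codom xi) <= s)%N.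
    apply: max_unity_roots; rewrite ?lt0n //.
      by apply/allP => _ /codomP[i ->]; rewrite unity_rootE; exact: xs.
    by rewrite (map_inj_uniq xi_inj) enum_uniq.
  by rewrite size_codom card_ord leqNgt ltn_ord.
have xi0 j : xi j != 0.
  by apply: contra_eq_neq (xi_root j) => ->; rewrite expr0n gtn_eqF ?d0 // eq_sym oner_eq0.
have shift : perm_eq (codom xi) [seq xi i * x | x <- codom xi].
  have u : uniq [seq xi i * x | x <- codom xi].
    by rewrite (map_inj_uniq (mulfI (xi0 i))) (map_inj_uniq xi_inj) enum_uniq.
  apply: uniq_perm => //; first by rewrite (map_inj_uniq xi_inj) enum_uniq.
  move=> x; apply/esym; apply: (uniq_min_size u _ _).2.
  - by move=> _ /mapP[_ /codomP[j ->] ->]; apply: roots_exhaust; rewrite ?exprMn ?xi_root ?mulr1.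
  - by rewrite !size_map.
have sumE : \sum_i xi i ^+ s = \sum_(x <- codom xi) x ^+ s by rewrite big_map big_enum.
have : \sum_i xi i ^+ s = xi i ^+ s * \sum_i xi i ^+ s.
  rewrite {1}sumE (perm_big _ shift) big_map sumE mulr_sumr.
  by apply: eq_bigr => x _; rewrite exprMn.
move/eqP; rewrite -{1}[X in X == _]mul1r -subr_eq0 -mulrBl mulf_eq0 subr_eq0 eq_sym.
by rewrite (negPf is1) => /eqP.
Qed.

End RootsOfUnity.

Section LaurentConstants.
Variable F : fieldType.

Lemma lconst_is_zmod_morphism : zmod_morphism (@lconst F : F -> laurent_ring F).
Proof.
move=> a b; apply: val_inj; rewrite raddfB /= /laurent_frac expr0 tofrac1 !divr1.
by rewrite polyCB tofracB.
Qed.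

Lemma lconst_is_monoid_morphism : monoid_morphism (@lconst F : F -> laurent_ring F).
Proof.
split=> [|a b]; apply: val_inj.
  by rewrite rmorph1 /= /laurent_frac expr0 tofrac1 !divr1.
rewrite rmorphM /= /laurent_frac expr0 tofrac1 !divr1.
by rewrite polyCM tofracM.
Qed.

HB.instance Definition _ := GRing.isZmodMorphism.Build F (laurent_ring F)
  (@lconst F) lconst_is_zmod_morphism.
HB.instance Definition _ := GRing.isMonoidMorphism.Build F (laurent_ring F)
  (@lconst F) lconst_is_monoid_morphism.

End LaurentConstants.

Section CharacterIdempotents.
Variables (F : fieldType) (q : laurent F) (d n : nat) (xi : 'I_d -> F).
Hypotheses (xi_inj : injective xi) (xi_root : forall i, xi i ^+ d = 1).
Hypothesis d_neq0 : d%:R != 0 :> F.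

Local Notation sc c := (scal (lconst c) : yh q d n).
(** [u j] is the inverse of [t_j], as [t_j^d = 1]; [P c j] is the factor of [Echi] at [j] for a
    character with value [c] there. *)
Local Notation u j := (yt q d j ^+ d.-1 : yh q d n).
Local Notation P c j := (scal (dinv F d) * \sum_(s < d) sc (c ^+ s) * u j ^+ s).

Let d_gt0 : (0 < d)%N.
Proof. by rewrite lt0n; apply: contraNneq d_neq0 => ->. Qed.

Lemma ytX_d (j : 'I_n) : yt q d j ^+ d = 1.
Proof.
apply/eqP; rewrite -subr_eq0 -(rmorph1 (@cls _ (@yh_rel F q d n))) -rmorphXn -rmorphB.
by apply/eqP/cls_rel/yh_rel_tpow.
Qed.

Lemma ytC (i j : 'I_n) : GRing.comm (yt q d i) (yt q d j).
Proof.
apply/eqP; rewrite -subr_eq0 -!rmorphM -rmorphB.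
by apply/eqP/cls_rel/yh_rel_tcomm.
Qed.

Lemma comm_yt_factor (i j : 'I_n) c : GRing.comm (u i) (P c j).
Proof.
apply: commrM; first exact: esym (scal_central _ _).
apply: commr_sum => s _; apply: commrM; first exact: esym (scal_central _ _).
by apply/commrX/commrX/commr_sym/commrX/ytC.
Qed.

Lemma yt_factor (j : 'I_n) c : c ^+ d = 1 -> u j * P c j = sc c^-1 * P c j.
Proof.
move=> cd.
have c0 : c != 0.
  by apply: contra_eq_neq cd => ->; rewrite expr0n gtn_eqF ?d_gt0 // eq_sym oner_eq0.
rewrite !mulrA -!(scal_central (dinv F d)) -!mulrA; congr (_ * _).
rewrite !mulr_sumr.
have ud : u j ^+ d = 1 by rewrite -exprM mulnC exprM ytX_d expr1n.
case: d cd ud d_gt0 => // e cd ud _.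
(* Multiplication by [u j] shifts the powers cyclically: the top term on the left meets the term
   [s = 0] on the right, since [u j ^+ d = 1] and [c ^+ d.-1 = c^-1]. *)
rewrite [LHS]big_ord_recr [RHS]big_ord_recl /= addrC; congr (_ + _).
  rewrite expr0 rmorph1 rmorph1 mulr1 mulr1 mulrA -scal_central -mulrA -exprS ud mulr1.
  by have -> : c ^+ e = c^-1 by apply: (mulfI c0); rewrite -exprS cd mulfV.
apply: eq_bigr => s _; rewrite mulrA -scal_central -mulrA -exprS /bump /= add1n.
by rewrite mulrA -!rmorphM /= (exprS c) mulKf.
Qed.

Lemma yt_Echi (j : 'I_n) (chi : 'I_n -> F) : chi j ^+ d = 1 ->
  u j * Echi q d chi = sc (chi j)^-1 * Echi q d chi.
Proof.
move=> chid; rewrite /Echi.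
(* Both sides equal the product of [G], altered only at [j]. *)
set G := fun i => if i == j then u j * P (chi i) i else P (chi i) i.
rewrite (@mul_prod_at _ _ (u j) _ G j); last by rewrite /G eqxx.
- rewrite (@mul_prod_at _ _ (sc (chi j)^-1) _ G j) //.
  + exact: index_enum_uniq.
  + exact: mem_index_enum.
  + by move=> i /negPf ij; rewrite /G ij; split=> //; exact: scal_central.
  + by rewrite /G eqxx yt_factor.
- exact: index_enum_uniq.
- exact: mem_index_enum.
- by move=> i /negPf ij; rewrite /G ij; split=> //; exact: comm_yt_factor.
Qed.

(** [u j] acts on the product by both eigenvalues; their difference is a nonzero constant, hence
    invertible. *)
Lemma Echi_orthogonal (chi chi' : 'I_n -> F) (j : 'I_n) :
  chi j ^+ d = 1 -> chi' j ^+ d = 1 -> chi j != chi' j ->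
  Echi q d chi * Echi q d chi' = 0.
Proof.
move=> cd cd' cc'.
have uC : GRing.comm (u j) (Echi q d chi).
  by apply: commr_prod => i _; exact: comm_yt_factor.
have : sc (chi j)^-1 * (Echi q d chi * Echi q d chi') =
       sc (chi' j)^-1 * (Echi q d chi * Echi q d chi').
  by rewrite !mulrA -yt_Echi // uC scal_central -!mulrA yt_Echi.
move/eqP; rewrite -subr_eq0 -mulrBl -!rmorphB /=.
set c := (X in sc X) => /eqP e.
have c0 : c != 0 by rewrite subr_eq0 (inj_eq invr_inj).
by rewrite -[LHS]mul1r -(rmorph1 scal) -(rmorph1 (@lconst F)) -(mulVf c0) !rmorphM /= -mulrA e mulr0.
Qed.

(** Summed over the roots, all powers [s] except 0 vanish, which leaves [d] times [1/d]. *)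
Lemma sum_factor (j : 'I_n) : \sum_(i < d) P (xi i) j = 1.
Proof.
rewrite -mulr_sumr exchange_big /=.
under eq_bigr do rewrite -mulr_suml -!rmorph_sum /= sum_rootsX //.
case: d d_gt0 d_neq0 => // e _ e0.
rewrite big_ord_recl big1 => [/=|s _]; last by rewrite /= !rmorph0 mul0r.
by rewrite expr0 mulr1 addr0 -!rmorphM /= mulVf // !rmorph1.
Qed.

Lemma sum_Echi : \sum_(f : {ffun 'I_n -> 'I_d}) Echi q d (xi \o f) = 1.
Proof.
rewrite /Echi -(bigA_distr_bigA (fun j i => P (xi i) j)) big1 // => j _.
exact: sum_factor.
Qed.

End CharacterIdempotents.

Section OrbitIdempotents.
Variables (F : fieldType) (q : laurent F) (d n : nat) (xi : 'I_d -> F).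
Hypotheses (xi_inj : injective xi) (xi_root : forall i, xi i ^+ d = 1).
Hypothesis d_neq0 : d%:R != 0 :> F.
Variable pi : forall mu : composition d n, 'I_(m_mu mu) -> 'S_n.
Hypothesis pi_reps : forall mu, min_coset_reps (@pi mu).

Lemma chi_mu_rep_word mu k :
  chi_mu xi (@pi mu) k = xi \o rep_word pi (Tagged (fun mu => 'I_(m_mu mu)) k).
Proof.
apply: functional_extensionality_dep => j /=; rewrite ffunE /= /chi_mu /char_act /chi1.
(* The default value of [chi1] never occurs, since every point lies in a block. *)
case: pickP => [i|/(_ (block mu ((pi k)^-1%g j)))]; last first.
  by move/negbT/negP; case; exact: blockP.
by move=> ij; congr xi; apply: in_block_inj ij (blockP _ _).
Qed.

Lemma sum_E_mu : \sum_mu E_mu xi (@pi mu) q = 1.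
Proof.
rewrite -(sum_Echi q n xi_inj xi_root d_neq0) /E_mu sig_big_dep /=.
rewrite [RHS](reindex (rep_word pi)) /=; last first.
  apply/onW_bij/inj_card_bij; first exact: rep_word_inj.
  (* A section of [rep_word] is injective; this gives the cardinality bound that turns injectivity
     into bijectivity. *)
  have /fin_all_exists[h hK] := rep_word_surj pi_reps.
  by apply: (leq_card h); apply: can_inj hK.
by apply: eq_bigr => -[mu k] _; rewrite chi_mu_rep_word.
Qed.

Lemma E_mu_orthogonal mu nu :
  mu != nu -> E_mu xi (@pi mu) q * E_mu xi (@pi nu) q = 0.
Proof.
move=> mn; rewrite /E_mu mulr_suml big1 // => k _; rewrite mulr_sumr big1 // => l _.
have : rep_word pi (Tagged (fun mu => 'I_(m_mu mu)) k) !=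
       rep_word pi (Tagged (fun mu => 'I_(m_mu mu)) l).
  by apply: contra_neq mn => /(rep_word_inj pi_reps)/(congr1 tag).
rewrite !chi_mu_rep_word.
move: (rep_word _ _) (rep_word _ _) => h f /eqP fh.
have [j fhj] : exists j, f j != h j.
  apply/existsP; rewrite -negb_forall; apply/negP => /forallP e.
  by apply: fh; apply/ffunP => j; apply/eqP.
by apply: (Echi_orthogonal q d_neq0 (j := j)); rewrite /= ?xi_root ?(inj_eq xi_inj).
Qed.

End OrbitIdempotents.

(** * Passage to the quotient and to the direct sum *)

Lemma theta_mu_surj (F : fieldType) (q : laurent F) (d n : nat)
    (mu : composition d n) (xi : 'I_d -> F) (pi : 'I_(m_mu mu) -> 'S_n)
    (y : corner (E_mu_ftl xi pi q)) : exists x, theta_mu x = y.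
Proof.
have /asboolP[b yE] := valP y; have [a aE] := cls_surj b.
exists (corner_proj _ a); apply: val_inj; rewrite yE aE.
exact: rmorphM.
Qed.

Theorem theorem4p7 (R : realType) (d n : nat)
    (d_gt0 : (0 < d)%N) (n_gt0 : (0 < n)%N)
    (q : laurent R[i]) (q_def : q = lpow R[i] 1)
    (xi : 'I_d -> R[i]) (xi_inj : injective xi)
    (xi_root : forall i, xi i ^+ d = 1)
    (pi : forall mu : composition d n, 'I_(m_mu mu) -> 'S_n)
    (pi_reps : forall mu, min_coset_reps (pi mu))
    (rho : forall mu, hecke_mu mu q -> tl_mu mu q)
    (rhoP : forall mu, is_rho (rho mu))
    (tPsi : forall mu, corner (E_mu xi (pi mu) (lsq q)) ->
                       mat_alg (hecke_mu mu (lsq q)) (m_mu mu))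
    (tPsiP : forall mu, is_tPsi (tPsi mu))
    (Psi : forall mu, corner (E_mu xi (pi mu) q) ->
                      mat_alg (hecke_mu mu q) (m_mu mu))
    (PsiP : forall mu, is_Psi (tPsi mu) (Psi mu))
    (Phi : forall mu, mat_alg (hecke_mu mu q) (m_mu mu) ->
                      corner (E_mu xi (pi mu) q))
    (PhiP : forall mu, cancel (Psi mu) (Phi mu) /\ cancel (Phi mu) (Psi mu))
    (psi : forall mu, ftl_block q xi pi mu -> mat_alg (tl_mu mu q) (m_mu mu))
    (psiP : forall mu, is_psi (rho mu) (Psi mu) (psi mu))
    (phi : forall mu, mat_alg (tl_mu mu q) (m_mu mu) -> ftl_block q xi pi mu)
    (phiP : forall mu, is_phi (rho mu) (Phi mu) (phi mu)) :
  (forall mu : composition d n,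
     alg_iso_for (psi mu) (phi mu)
       (@corner_mul _ _ _) (corner_one (E_mu_ftl xi (pi mu) q)) *%R 1)
  /\ alg_iso_for (psi_sum psi) (phi_sum phi) *%R 1 *%R 1.
Proof.
have d_neq0 : d%:R != 0 :> R[i] by rewrite Num.Theory.pnatr_eq0 -lt0n.
have psiK mu : cancel (psi mu) (phi mu).
  move=> y; have [x <-] := theta_mu_surj y.
  rewrite (proj2 (psiP mu)); apply: etrans (proj2 (phiP mu) _) _.
  by rewrite (proj1 (PhiP mu)).
have phiK mu : cancel (phi mu) (psi mu).
  move=> y.
  have [x <-] : exists x, map_mx (rho mu) x = y.
    have [h hK] := choice (rho_surj (rhoP mu)).
    by exists (map_mx h y); apply/matrixP => i j; rewrite !mxE hK.
  rewrite (proj2 (phiP mu)) (proj2 (psiP mu)).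
  by rewrite (proj2 (PhiP mu)).
have psiL mu : linear (psi mu) by have [[]] := psiP mu.
have psiM mu : {morph psi mu : x y / corner_mul x y >-> x * y} by have [[]] := psiP mu.
have psi1 mu : psi mu (corner_one _) = 1 by have [[]] := psiP mu.
pose E mu := E_mu_ftl xi (pi mu) q.
(* [corner_one] is a left unit of the corner by construction; it is a right
   unit because [psi mu] is injective and multiplicative. *)
have EbE mu b : E mu * b * E mu = E mu * b.
  have := psiM mu (corner_proj _ b) (corner_one _); rewrite psi1 mulr1.
  by move/(can_inj (psiK mu))/(congr1 val) => /=; rewrite mulr1.
have EE mu : E mu * E mu = E mu by have := EbE mu 1; rewrite mulr1.
have sumE : \sum_mu E mu = 1.
  rewrite -(rmorph1 (@cls _ (@ftl_rel _ q d n))) -(sum_E_mu q xi_inj xi_root d_neq0 pi_reps).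
  by rewrite raddf_sum.
have E_orth mu nu : mu != nu -> E mu * E nu = 0.
  move=> mn; rewrite -(rmorph0 (@cls _ (@ftl_rel _ q d n))).
  by rewrite -(E_mu_orthogonal q xi_inj xi_root d_neq0 pi_reps mn) rmorphM.
split=> [mu|].
  by split; [exact: (proj1 (psiP mu))|exact: psiK|exact: phiK].
split; first split.
- move=> c x y; apply: functional_extensionality_dep => mu.
  rewrite /psi_sum -[RHS]/(c *: psi mu _ + psi mu _) -psiL; congr (psi mu _).
  apply: val_inj => /=; rewrite mulrDr; congr (_ + _).
  (* Scalars act on a corner from the right and on [ftl] from the left; centrality reconciles the
     two. *)
  by rewrite -[c *: x]/(scal c * x) scal_central mulrA.
- move=> x y; apply: functional_extensionality_dep => mu.
  rewrite /psi_sum -[RHS]/(psi mu _ * psi mu _) -psiM; congr (psi mu _).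
  by apply: val_inj; rewrite /= -!/(E mu) !mulrA EbE.
- by apply: functional_extensionality_dep => mu; exact: psi1.
- move=> x; rewrite /phi_sum /psi_sum -[RHS]mul1r -sumE mulr_suml.
  by apply: eq_bigr => mu _; rewrite psiK.
- move=> M; apply: functional_extensionality_dep => mu; rewrite /psi_sum /phi_sum.
  rewrite -[RHS]phiK; congr (psi mu _); apply: val_inj => /=.
  (* Left multiplication by [E nu] fixes its own block, so by orthogonality [E mu] kills every
     summand with [nu != mu]. *)
  have phiE nu : val (phi nu (M nu)) = E nu * val (phi nu (M nu)).
    by have /asboolP[b ->] := valP (phi nu (M nu)); rewrite mulrA EE.
  rewrite -/(E mu) mulr_sumr (bigD1 mu) //= -phiE big1 ?addr0 // => nu nm.
  by rewrite phiE mulrA E_orth ?mul0r // eq_sym.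
Qed.
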